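(* For every $n\in\mathbb{N}$ let $$\Gamma_n=\sup\{\Gamma(\mu):\ \mu\text{ is an isotropic log-concave probability measure on }\mathbb{R}^n\}.$$ Then there exist absolute constants $c_1,c_2>0$ such that $c_1 n\le \Gamma_n\le c_2 n$ for every $n\in\mathbb{N}$.
   Context: A convex body in $\mathbb{R}^n$ is a compact convex set with nonempty interior; $B_2^n$ is the Euclidean unit ball. For a Borel probability measure $\mu$ on $\mathbb{R}^n$ and a convex body $A$, the $\mu$-perimeter of $A$ is $$\mu^+(\partial A)=\liminf_{\epsilon\to0^+}\frac{\mu(A+\epsilon B_2^n)-\mu(A)}{\epsilon},$$ and the maximal perimeter of $\mu$ is $\Gamma(\mu)=\sup\{\mu^+(\partial A): A\text{ is a convex body in }\mathbb{R}^n\}$. A log-concave probability measure on $\mathbb{R}^n$ is one with a density $f=e^{-\psi}$ with respect to Lebesgue measure, $\psi:\mathbb{R}^n\to(-\infty,\infty]$ convex. It is isotropic if $\int_{\mathbb{R}^n} x f(x)\,dx=0$ and its covariance matrix is the identity, i.e. $\int_{\mathbb{R}^n} x\otimes x\, f(x)\,dx=I_n$. *)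

(* Defs.v *)
From HB Require Import structures.
From mathcomp Require Import all_boot all_order all_algebra.
From mathcomp Require Import all_classical all_reals all_analysis measurable_realfun.
Import Order.TTheory GRing.Theory Num.Theory.
Import numFieldNormedType.Exports.

Set Implicit Arguments.
Unset Strict Implicit.
Unset Printing Implicit Defensive.

Local Open Scope classical_set_scope.
Local Open Scope ring_scope.

(* The Borel sigma-algebra of R^n, generated by the open sets. *)
HB.instance Definition _ (R : realType) (n : nat) :=
  @isMeasurable.Build (sigma_display (@open 'rV[R]_n)) 'rV[R]_n
    <<s @open 'rV[R]_n >> (@sigma_algebra0 _ setT _) (@sigma_algebraC _ _)
    (@sigma_algebra_bigcup _ setT _).

Section measurability.
Context d (T : measurableType d) (R : realType).

(* Equivalently, the Borel sigma-algebra is the product sigma-algebra. *)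
Lemma measurable_fun_rVP n (f : T -> 'rV[R]_n) :
  measurable_fun setT f <->
  forall i, measurable_fun setT (fun x => f x 0 i).
Proof.
split=> [mf i|mf].
  move=> _ /= B mB; rewrite setTI.
  have mc : measurable_fun setT (fun v : 'rV[R]_n => v 0 i).
    apply: (measurability _ (RGenOpens.measurableE R)) => _ [_ [a [b ->]] <-].
    rewrite setTI; apply: sub_sigma_algebra.
    have /continuousP := @coord_continuous R 1 n 0 i.
    by apply; exact: interval_open.
  have := mc measurableT B mB; rewrite setTI => mcB.
  by have := mf measurableT _ mcB; rewrite setTI.
apply: (@measurability _ _ _ _ setT f (@open 'rV[R]_n)) => //.
move=> _ [U oU <-]; rewrite setTI.
pose bx (p : 'rV[rat]_n * rat) : set 'rV[R]_n :=
  [set v | forall i, `|v 0 i - ratr (p.1 0 i)| < ratr p.2].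
have -> : f @^-1` U = \bigcup_(p in [set p | bx p `<=` U]) (f @^-1` bx p).
  rewrite -preimage_bigcup; congr (_ @^-1` _).
  apply/seteqP; split=> [v Uv|v [p /= pU /pU]//].
  have [e e0 eU] : exists2 e : R, 0 < e & ball v e `<=` U.
    by apply/nbhs_ballP; exact: open_nbhs_nbhs.
  have [q] := rat_in_itvoo (divr_gt0 e0 (ltr0n R 2)).
  rewrite in_itv/= => /andP[q0 qe].
  have /choice[r rP] : forall i, exists r : rat,
      `|v 0 i - ratr r| < ratr q.
    move=> i; have [r] : exists r : rat, ratr r \in `](v 0 i), (v 0 i + ratr q)[.
      by apply: rat_in_itvoo; rewrite ltrDl.
    rewrite in_itv/= => /andP[vr rv]; exists r.
    by rewrite distrC gtr0_norm ?subr_gt0// ltrBlDl.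
  exists (\row_i r i, q) => /=; last by move=> i; rewrite mxE.
  move=> w /= bw; apply: eU; split=> // a i; rewrite (ord1 a).
  rewrite /ball/= (splitr e); have := bw i; rewrite mxE => bwi.
  rewrite (le_lt_trans (ler_distD (ratr (r i)) _ _))//.
  by rewrite ltrD//; [exact: lt_trans (rP i) _|rewrite distrC; exact: lt_trans qe].
rewrite bigcup_mkcond; apply: countable_bigcupT_measurable => // p.
case: ifPn => // _.
have -> : f @^-1` bx p =
    \bigcap_(i in [set: 'I_n]) [set x | `|f x 0 i - ratr (p.1 0 i)| < ratr p.2].
  by apply/seteqP; split=> [x bxx i _|x bxx i]; exact: bxx.
apply: fin_bigcap_measurable => // i _.
rewrite -[X in measurable X]setTI.
have -> : [set x | `|f x 0 i - ratr (p.1 0 i)| < ratr p.2] =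
    (fun x => f x 0 i) @^-1`
      `](ratr (p.1 0 i) - ratr p.2), (ratr (p.1 0 i) + ratr p.2)[.
  by apply/seteqP; split=> x; rewrite /preimage/= in_itv/= ltr_distl.
by apply: mf => //; exact: measurable_itv.
Qed.
End measurability.

Section lebesgue_rV.
Context (R : realType).
Local Open Scope ereal_scope.

Definition rV_cons n (p : R * 'rV[R]_n) : 'rV[R]_n.+1 :=
  row_mx (p.1%:M : 'rV_1) p.2.

Let rV_uncons n (v : 'rV[R]_n.+1) : R * 'rV[R]_n :=
  (v 0%R 0%R, rsubmx (v : 'rV_(1 + n))).

Let rV_consK n : cancel (@rV_cons n) (@rV_uncons n).
Proof.
case=> x v; rewrite /rV_uncons /rV_cons row_mxKr/=; congr (_, _).
rewrite mxE; case: splitP => // j _.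
by rewrite mxE (ord1 j) eqxx mulr1n.
Qed.

Lemma measurable_coord n (i : 'I_n) :
  measurable_fun setT (fun v : 'rV[R]_n => v 0%R i).
Proof. by have /measurable_fun_rVP := @measurable_id _ 'rV[R]_n setT. Qed.

Lemma measurable_rV_cons n : measurable_fun setT (@rV_cons n).
Proof.
apply/measurable_fun_rVP => i; rewrite /rV_cons.
under eq_fun do rewrite mxE.
case: (fintype.split (i : 'I_(1 + n))) => j.
  under eq_fun do rewrite mxE (ord1 j) eqxx mulr1n.
  exact: measurable_fst.
apply: (measurableT_comp (measurable_coord j)).
exact: measurable_snd.
Qed.

Let measurable_rV_uncons n : measurable_fun setT (@rV_uncons n).
Proof.
apply/measurable_fun_pairP; split; first exact: measurable_coord.
apply/measurable_fun_rVP => i.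
under eq_fun do rewrite /= mxE.
exact: measurable_coord.
Qed.

Section step.
Variables (n : nat) (m : {sigma_finite_measure set 'rV[R]_n -> \bar R}).

Definition lebesgue_rVS : set 'rV[R]_n.+1 -> \bar R :=
  pushforward (lebesgue_measure \x m) (@rV_cons n).

Let lebesgue_rVS0 : lebesgue_rVS set0 = 0.
Proof. by apply: measure0; exact: measurable_rV_cons. Qed.

Let lebesgue_rVS_ge0 A : 0 <= lebesgue_rVS A.
Proof. by apply: measure_ge0; exact: measurable_rV_cons. Qed.

Let lebesgue_rVS_sigma_additive : semi_sigma_additive lebesgue_rVS.
Proof.
by apply: measure_semi_sigma_additive; exact: measurable_rV_cons.
Qed.

HB.instance Definition _ := isMeasure.Build _ _ _ lebesgue_rVS
  lebesgue_rVS0 lebesgue_rVS_ge0 lebesgue_rVS_sigma_additive.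

Let sigma_finite_lebesgue_rVS : sigma_finite setT lebesgue_rVS.
Proof.
have /sigma_finiteP[F [TF ndF Foo]] := sigma_finiteT (@lebesgue_measure R).
have /sigma_finiteP[G [TG ndG Goo]] := sigma_finiteT m.
exists (fun k => @rV_uncons n @^-1` (F k `*` G k)).
  rewrite -preimage_bigcup (_ : \bigcup_k _ = setT) ?preimage_setT//.
  rewrite -setXTT TF TG; apply/seteqP; split=> [[x y] [k _ [/= Fx Gy]]|[x y]].
    by split; exists k.
  move=> [/= [k _ Fx] [l _ Gy]]; exists (maxn k l) => //; split => /=.
    by move: x Fx; exact/subsetPset/ndF/leq_maxl.
  by move: y Gy; exact/subsetPset/ndG/leq_maxr.
move=> k; have [mF Fk] := Foo k; have [mG Gk] := Goo k; split.
  by rewrite -[X in measurable X]setTI; apply: measurable_rV_uncons => //;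
    exact: measurableX.
rewrite /lebesgue_rVS /pushforward -comp_preimage.
rewrite (_ : _ \o _ = id); last by apply/funext => p /=; exact: rV_consK.
by rewrite preimage_id product_measure1E// lte_mul_pinfty// ge0_fin_numE.
Qed.

HB.instance Definition _ := Measure_isSigmaFinite.Build _ _ _ lebesgue_rVS
  sigma_finite_lebesgue_rVS.

End step.

(* n-dimensional Lebesgue measure, as the n-fold product measure transported to
   row vectors; it is pinned down by its values on boxes, lebesgue_rV_box. *)
Fixpoint lebesgue_rV n : {sigma_finite_measure set 'rV[R]_n -> \bar R} :=
  if n is k.+1 then lebesgue_rVS (lebesgue_rV k) else
  \d_(0%R : 'rV[R]_0).

Lemma lebesgue_rV_box n (B : 'I_n -> set R) :
  (forall i, measurable (B i)) ->
  lebesgue_rV n [set v | forall i, B i (v 0%R i)] =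
  \prod_(i < n) lebesgue_measure (B i).
Proof.
elim: n B => [|n ih] B mB.
  rewrite big_ord0 /= diracE mem_set// => -[].
  by [].
have -> /= : lebesgue_rV n.+1 = lebesgue_rVS (lebesgue_rV n) by [].
have mB' : measurable
    [set v : 'rV[R]_n | forall i : 'I_n, B (lift ord0 i) (v 0%R i)].
  rewrite (_ : [set v | _] = \bigcap_(i in [set: 'I_n])
      ((fun v : 'rV[R]_n => v 0%R i) @^-1` B (lift ord0 i))).
    apply: fin_bigcap_measurable => // i _.
    by rewrite -[X in measurable X]setTI; exact: measurable_coord.
  by apply/seteqP; split=> [v Bv i _|v Bv i]; exact: Bv.
rewrite big_ord_recl -ih// -product_measure1E//; last exact: mB.
rewrite /lebesgue_rVS /pushforward; congr ((lebesgue_measure \x _) _).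
apply/seteqP; split=> -[x v] /=.
  move=> xvB; split => /=.
    have := xvB ord0; rewrite /rV_cons mxE; case: splitP => // j _.
    by rewrite mxE (ord1 j) eqxx mulr1n.
  move=> i; have := xvB (lift ord0 i); rewrite /rV_cons mxE.
  case: splitP => [j|j [ij]]; first by rewrite (ord1 j).
  by rewrite (_ : j = i)//; exact/val_inj.
move=> [/= xB vB] i; rewrite /rV_cons mxE; case: splitP => [j|j] ij.
  rewrite mxE (ord1 j) eqxx mulr1n (_ : i = ord0)//.
  by apply/val_inj; rewrite /= ij (ord1 j).
by rewrite (_ : i = lift ord0 j)//; exact/val_inj.
Qed.

End lebesgue_rV.

Section convex_bodies.
Context (R : realType) (n : nat).
Implicit Types (A : set 'rV[R]_n) (mu : set 'rV[R]_n -> \bar R).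

(* The norm `|x| of the library on 'rV[R]_n is the sup norm. *)
Definition euclid_norm (x : 'rV[R]_n) : R :=
  Num.sqrt (\sum_(i < n) x 0 i ^+ 2).

Definition euclid_ball : set 'rV[R]_n := [set x | euclid_norm x <= 1].

Definition parallel_body A (eps : R) : set 'rV[R]_n :=
  [set x + eps *: y | x in A & y in euclid_ball].

Definition convex_body A : Prop :=
  [/\ compact A, convex_set A & A° !=set0].

Definition perimeter mu A : \bar R :=
  limf_einf (fun eps : R => (mu (parallel_body A eps) - mu A) * (eps^-1)%:E)%E
    0^'+.

Definition max_perimeter mu : \bar R :=
  ereal_sup [set perimeter mu A | A in convex_body].

End convex_bodies.

Section isotropic_log_concave.
Context (R : realType) (n : nat).
Local Open Scope ereal_scope.
Implicit Types (psi f : 'rV[R]_n -> \bar R) (mu : set 'rV[R]_n -> \bar R).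

(* 0 * +oo = 0 in \bar R, so t = 0 and t = 1 give no constraint when psi takes
   the value +oo. *)
Definition econvex_function psi : Prop :=
  forall (x y : 'rV[R]_n) (t : R), (0 <= t <= 1)%R ->
    psi (t *: x + (1 - t) *: y)%R <= t%:E * psi x + (1 - t)%:E * psi y.

Definition log_concave f : Prop :=
  exists psi, [/\ forall x, psi x != -oo, econvex_function psi
    & forall x, f x = expeR (- psi x)].

(* Up to modification on a null set, a density may be taken Borel measurable:
   a log-concave f becomes so when psi is replaced by its lower semicontinuous
   hull, which alters psi only on the boundary of the convex set {psi < +oo}. *)
Definition density mu f : Prop :=
  measurable_fun [set: 'rV[R]_n] f /\
  forall A, measurable A -> mu A = \int[lebesgue_rV R n]_(x in A) f x.

(* The integrals are \bar R-valued; an integral of the library is finite only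
   when the positive and negative parts both have finite integral. *)
Definition isotropic f : Prop :=
  (forall i, \int[lebesgue_rV R n]_x ((x 0%R i)%:E * f x) = 0) /\
  (forall i j, \int[lebesgue_rV R n]_x ((x 0%R i * x 0%R j)%:E * f x) =
    (1%:M i j)%:E).

Definition isotropic_log_concave mu : Prop :=
  exists f, [/\ density mu f, log_concave f & isotropic f].

Definition Gamma : \bar R :=
  ereal_sup [set max_perimeter mu |
    mu in [set mu : probability 'rV[R]_n R | isotropic_log_concave mu]].

End isotropic_log_concave.

(* Main.v *)
From HB Require Import structures.
Require Import Defs.
From mathcomp Require Import all_boot all_order all_algebra.
From mathcomp Require Import all_classical all_reals all_analysis measurable_realfun.
From mathcomp Require Import ring lra.
Import Order.TTheory GRing.Theory Num.Theory.
Import numFieldNormedType.Exports.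
Set Implicit Arguments.
Unset Strict Implicit.
Unset Printing Implicit Defensive.
Local Open Scope classical_set_scope.
Local Open Scope ring_scope.

(** The perimeter of a convex body is never computed: everything happens at
    the level of mu (A + eps B) - mu A for a fixed small eps, so that neither
    boundaries nor gradients of the density F = exp (- psi) appear.

    Upper bound.  Suppose that F drops by a factor of at most exp D from any
    point x to any point v of the centred ball of radius r.  Log-concavity then
    gives, with s = eps / r,
      F (x + eps u) >= exp (- s D) F (x / (1 - s))      for every unit vector u,
    since x + eps u is the mean of x / (1 - s) and r u with weights 1 - s and
    s; the same lower bound holds for F x itself.  Let A be cut out by finitely
    many half-spaces with unit outer normals u_j, and let C_j be the cell of
    the points outside A whose most violated constraint is the j-th one.
    The translate C_j + eps u_j lies in C_j and outside the eps-shell of A, so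
    the part of the shell in C_j has at most the mass of C_j minus that of
    C_j + eps u_j.  Summing over j bounds the mass of the shell by
      1 - exp (- s D) (1 - s)^n <= (eps / r) (D + n),
    hence every perimeter is at most (D + n) / r (perimeter_le).  An arbitrary
    convex body is a countable intersection of half-spaces, and the bound
    passes to the limit because it does not involve their number.

    It remains to see that r can be an absolute constant and D a multiple of n
    when F is isotropic (log_concave_star).  Compare F with its value at any
    point x1: the superlevel set L = {F >= exp (- D) F x1} carries almost all
    the mass, because the midpoint inequality bounds F outside L by a small
    multiple of F ((x + x1) / 2), whose integral is 2^n.  If the convex set L
    did not contain the ball of radius r, it would lie in a half-space
    {<x, u> <= r}, so the positive part of X = <x, u> would have small
    expectation.  That contradicts EX = 0 and EX^2 = 1, for the
    Prekopa-Leindler inequality yields the reverse Hoelder inequality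
    P(Y >= 0) E(Y+)^2 <= 4 (E Y+)^2 for affine Y (reverse_hoelder), and this
    bounds E X+ from below by an absolute constant (dot_pos_part_lower).

    Lower bound.  For the uniform measure on the isotropic cube, take a cube A
    smaller by the factor 1 - 1 / (2n).  The n slabs of thickness eps glued to
    the facets x_i = a of A are disjoint, lie in A + eps B, and each has mass
    of order eps (perimeter_box_ge). *)

(** * Lebesgue measure on row vectors *)

Section integration.
Context (R : realType).
Local Open Scope ereal_scope.
Local Notation lam := (lebesgue_rV R).
Local Notation leb := (@lebesgue_measure R).

Lemma ge0_integral_rVS n (g : 'rV[R]_n.+1 -> \bar R) :
  measurable_fun setT g -> (forall x, 0 <= g x) ->
  \int[lam n.+1]_x g x = \int[leb]_t \int[lam n]_y g (rV_cons (t, y)).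
Proof.
move=> mg g0.
have mc := @measurable_rV_cons R n.
transitivity (\int[pushforward (leb \x lam n) (@rV_cons R n)]_x g x) => //.
rewrite ge0_integral_pushforward// preimage_setT fubini_tonelli1//.
  by apply: measurableT_comp.
by move=> x /=.
Qed.

Lemma measurable_section_rVS n (g : 'rV[R]_n.+1 -> \bar R) (t : R) :
  measurable_fun setT g -> measurable_fun setT (fun y => g (rV_cons (t, y))).
Proof.
move=> mg; apply: (measurableT_comp mg).
apply: (measurableT_comp (@measurable_rV_cons R n)).
exact: measurable_fun_pair.
Qed.

Lemma measurable_integral_rVS n (g : 'rV[R]_n.+1 -> \bar R) :
  measurable_fun setT g -> (forall x, 0 <= g x) ->
  measurable_fun setT (fun t : R => \int[lam n]_y g (rV_cons (t, y))).
Proof.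
move=> mg g0.
have mc := @measurable_rV_cons R n.
apply: (@measurable_fun_fubini_tonelli_F _ _ _ _ _ (lam n) (g \o @rV_cons R n)).
  by apply: measurableT_comp.
by move=> x /=.
Qed.

(** The image of Lebesgue measure under t |-> c t + a, scaled by c, agrees with
    Lebesgue measure on intervals. *)
Lemma ge0_integral_affine1 (g : R -> \bar R) (c a : R) : (0 < c)%R ->
  measurable_fun setT g -> (forall x, 0 <= g x) ->
  \int[leb]_t g (c * t + a)%R = c^-1%:E * \int[leb]_t g t.
Proof.
move=> c0 mg g0.
pose phi (t : measurableTypeR R) : measurableTypeR R := (c * t + a)%R.
have mphi : measurable_fun setT phi by apply: measurable_funD => //; apply: measurable_funM.
have -> : \int[leb]_t g (c * t + a)%R = \int[pushforward leb phi]_t g t.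
  by rewrite ge0_integral_pushforward// preimage_setT.
have cc : (0 <= c)%R by exact: ltW.
have H A : measurable A -> leb A = mscale (NngNum cc) (pushforward leb phi) A.
  move=> mA.
  apply: lebesgue_measure_unique => //= _ [[x y] _ <-] /=.
  rewrite /mscale /pushforward /=.
  have -> : pushforward leb phi `]x, y] = leb `]((x - a) / c)%R, ((y - a) / c)%R].
    congr (leb _); apply/seteqP; split=> t;
      rewrite /phi /= !in_itv /= ltr_pdivrMr// ler_pdivlMr//;
      by rewrite ltrBlDr lerBrDr mulrC.
  rewrite !lebesgue_measure_itv/= !lte_fin ltr_pM2r ?invr_gt0// ltrD2r.
  case: ifPn => _; last by rewrite mule0.
  by rewrite -EFinB -EFinM; congr (_%:E); field; lra.
rewrite (eq_measure_integral (mscale (NngNum cc) (pushforward leb phi)) (m1 := leb)); last first.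
  by move=> A mA _; exact: H.
rewrite ge0_integral_mscale//= muleA -EFinM mulVf ?mul1e//.
by rewrite gt_eqF.
Qed.

Lemma rV_consE n (t : R) (y : 'rV[R]_n) (c : R) (v : 'rV[R]_n.+1) :
  (c *: rV_cons (t, y) + v)%R = rV_cons ((c * t + v 0%R 0%R)%R,
   (c *: y + rsubmx (v : 'rV_(1 + n)))%R).
Proof.
apply/rowP => i; rewrite /rV_cons !mxE; case: splitP => j ij.
  have -> : i = ord0 by apply/val_inj; rewrite /= ij (ord1 j).
  by rewrite !mxE (ord1 j) eqxx !mulr1n.
rewrite !mxE; congr (_ + v _ _)%R.
exact/val_inj.
Qed.

Lemma measurable_affine n (c : R) (v : 'rV[R]_n) :
  measurable_fun setT (fun x : 'rV[R]_n => c *: x + v)%R.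
Proof.
apply/measurable_fun_rVP => i.
under eq_fun do rewrite !mxE.
by apply: measurable_funD => //; apply: measurable_funM => //; exact: measurable_coord.
Qed.

(** Peeling off one coordinate reduces this to the real line, each coordinate
    contributing a factor c^-1.  With c = 1 it is translation invariance. *)
Lemma ge0_integral_affine n (g : 'rV[R]_n -> \bar R) (c : R) (v : 'rV[R]_n) :
  (0 < c)%R -> measurable_fun setT g -> (forall x, 0 <= g x) ->
  \int[lam n]_x g (c *: x + v)%R = (c ^- n)%:E * \int[lam n]_x g x.
Proof.
move=> c0; elim: n g v => [|n IH] g v mg g0.
  rewrite expr0 invr1 mul1e; apply: eq_integral => x _; congr g.
  by apply/rowP => -[].
have mga : measurable_fun setT (fun x : 'rV[R]_n.+1 => g (c *: x + v)%R).
  by apply: (measurableT_comp mg); exact: measurable_affine.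
have mi := measurable_integral_rVS mg g0.
rewrite (ge0_integral_rVS mg g0) (ge0_integral_rVS mga) => [|x]; last exact: g0.
transitivity (\int[leb]_t ((c ^- n)%:E *
    \int[lam n]_y g (rV_cons ((c * t + v 0%R 0%R)%R, y)))).
  apply: eq_integral => t _.
  under eq_integral do rewrite rV_consE.
  apply: (IH (fun y => g (rV_cons (_, y)))) => [|x]; last exact: g0.
  exact: measurable_section_rVS.
pose G t := \int[lam n]_y g (rV_cons (t, y)).
have G0 t : 0 <= G t by exact: integral_ge0.
have mG : measurable_fun setT G by exact: mi.
transitivity (\int[leb]_t ((c ^- n)%:E * G (c * t + v 0%R 0%R)%R)); first by [].
rewrite -/G -[RHS]/((c ^- n.+1)%:E * \int[leb]_t G t).
have mGa : measurable_fun setT (fun t : R => G (c * t + v 0%R 0%R)%R).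
  apply: (measurableT_comp mG).
  by apply: measurable_funD => //; apply: measurable_funM.
clearbody G; clear mi mga.
rewrite ge0_integralZl// ?lee_fin ?invr_ge0 ?exprn_ge0 ?ltW//.
by rewrite ge0_integral_affine1// muleA -EFinM exprSr invfM.
Qed.

End integration.

(** * The Prekopa-Leindler inequality *)

Section prekopa_leindler.
Context (R : realType).
Local Open Scope ereal_scope.
Local Notation lam := (lebesgue_rV R).
Local Notation leb := (@lebesgue_measure R).

(** Fubini applied to the region under the graph of h.  The measurability of
    the level function is part of the conclusion because comparing integrals of
    two functions through their levels requires it. *)
Lemma layer_cake d (T : measurableType d)
    (mu : {sigma_finite_measure set T -> \bar R}) (h : T -> \bar R) :
  measurable_fun setT h -> (forall x, 0 <= h x) ->
  let level s := if (0 <= s)%R then mu [set x | s%:E < h x] else 0 in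
  measurable_fun setT level /\ \int[mu]_x h x = \int[leb]_s level s.
Proof.
move=> mh h0 level.
pose E := [set p : T * measurableTypeR R | (0 <= p.2)%R /\ p.2%:E < h p.1].
have mE : measurable E.
  rewrite (_ : E = (snd @^-1` `[0%R, +oo[) `&` [set p | p.2%:E < h p.1]); last first.
    by apply/seteqP; split=> [[x s]|[x s]]; rewrite /E /= in_itv/= andbT.
  apply: measurableI.
    by rewrite -[X in measurable X]setTI; exact: measurable_snd.
  rewrite -[X in measurable X]setTI; apply: measurable_fun_lte => //.
    by apply/measurable_EFinP; exact: measurable_snd.
  by apply: (measurableT_comp mh); exact: measurable_fst.
pose F (p : T * measurableTypeR R) : \bar R := (\1_E p)%:E.
have mF : measurable_fun setT F by apply/measurable_EFinP; exact: measurable_indic.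
have F0 p : 0 <= F p by rewrite lee_fin.
have levelE s : \int[mu]_x F (x, s) = level s.
  rewrite /level.
  transitivity (\int[mu]_x (\1_[set x | (0 <= s)%R /\ (s%:E < h x)%E] x)%:E).
    by apply: eq_integral => x _; rewrite /F !indicE; congr (_%:R%:E); rewrite !in_setE.
  case: ifPn => s0.
    rewrite integral_indic ?setIT//.
      by congr (mu _); apply/seteqP; split=> x //= -[].
    rewrite (_ : [set x | _] = setT `&` [set x | s%:E < h x]); last first.
      by apply/seteqP; split=> x //= -[].
    by apply: measurable_fun_lte.
  rewrite (_ : [set x | _] = set0) ?indic0 ?integral0//.
  by apply/seteqP; split=> x //= -[].
split.
  rewrite (_ : level = fun s => \int[mu]_x F (x, s)); last first.
    by apply/funext => s; rewrite levelE.
  exact: (@measurable_fun_fubini_tonelli_G _ _ _ _ _ mu F).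
transitivity (\int[mu]_x \int[leb]_s F (x, s)).
  apply: eq_integral => x _.
  transitivity (\int[leb]_s (\1_[set s : R | (0 <= s)%R /\ (s%:E < h x)%E] s)%:E); last first.
    by apply: eq_integral => s _; rewrite /F !indicE; congr (_%:R%:E); rewrite !in_setE.
  case: (h x) (h0 x) => [r r0| _|//].
    rewrite (_ : [set s : R | _ /\ _] = `[0%R, r[%classic); last first.
      by apply/seteqP; split=> s; rewrite /= in_itv/= lte_fin => /andP.
    rewrite integral_indic// setIT -[RHS]/(leb `[0%R, r[) lebesgue_measure_itv/= lte_fin.
    move: r0; rewrite lee_fin le_eqVlt => /predU1P[<-|->]; first by rewrite ltxx.
    by rewrite sube0.
  rewrite (_ : [set s : R | _ /\ _] = `[0%R, +oo[%classic); last first.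
    by apply/seteqP; split=> s; rewrite /= in_itv/= andbT ltry => // -[].
  by rewrite integral_indic// setIT -[RHS]/(leb `[0%R, +oo[) lebesgue_measure_itv/= ltry.
rewrite (@fubini_tonelli _ _ _ _ _ mu leb F)//.
by apply: eq_integral => s _; exact: levelE.
Qed.

Let lebesgue_preimage_half (a : R) (D : set R) : measurable D ->
  leb [set x | D (2^-1 * x + a)%R] = 2%:E * leb D.
Proof.
move=> mD.
have h2 : (0 < 2^-1 :> R)%R by rewrite invr_gt0.
pose g (x : R) : \bar R := (\1_D x)%:E.
have mg : measurable_fun setT g by apply/measurable_EFinP; exact: measurable_indic.
have g0 x : 0 <= g x by rewrite lee_fin.
have := @ge0_integral_affine1 R g 2^-1 a h2 mg g0.
have -> : \int[leb]_x g x = leb D by rewrite integral_indic// setIT.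
rewrite invrK => <-.
have mD' : measurable [set x | D (2^-1 * x + a)%R].
  have : measurable_fun setT (fun x : R => 2^-1 * x + a)%R.
    by apply: measurable_funD => //; apply: measurable_funM.
  by move=> /(_ measurableT _ mD); rewrite setTI.
by rewrite -[in LHS](setIT [set x | _]) -integral_indic.
Qed.

(** The translates K1 + min K2 and max K1 + K2 both lie in K1 + K2 and meet only
    at max K1 + min K2.  The half-sums are stated through C to avoid asking
    whether the sumset is measurable. *)
Lemma brunn_minkowski1_compact (K1 K2 C : set R) :
  compact K1 -> compact K2 -> K1 !=set0 -> K2 !=set0 -> measurable C ->
  (forall x y, K1 x -> K2 y -> C (2^-1 * (x + y))%R) ->
  leb K1 + leb K2 <= 2%:E * leb C.
Proof.
move=> cK1 cK2 K10 K20 mC K12C.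
have [m1 K1m1 m1max] : exists2 m1, K1 m1 & forall x, K1 x -> (x <= m1)%R.
  have [|m1 K1m1 H] := @compact_EVT_max R R idfun K1 K10 cK1.
    by apply: continuous_subspaceT => x; exact: cvg_id.
  by exists m1 => [|x K1x]; [exact: set_mem|exact: H (mem_set K1x)].
have [m2 K2m2 m2min] : exists2 m2, K2 m2 & forall x, K2 x -> (m2 <= x)%R.
  have [|m2 K2m2 H] := @compact_EVT_min R R idfun K2 K20 cK2.
    by apply: continuous_subspaceT => x; exact: cvg_id.
  by exists m2 => [|x K2x]; [exact: set_mem|exact: H (mem_set K2x)].
pose p := (2^-1 * (m1 + m2))%R.
have mC1 : measurable (C `&` `]-oo, p]) by exact: measurableI.
have mC2 : measurable (C `&` `]p, +oo[) by exact: measurableI.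
have -> : leb C = leb (C `&` `]-oo, p]) + leb (C `&` `]p, +oo[).
  rewrite -measureU//; last first.
    by apply/seteqP; split=> x //= [[_]]; rewrite !in_itv/= andbT => xp [_]; lra.
  congr (leb _); apply/seteqP; split=> [x Cx|x [[]|[]]//] /=.
  by have [xp|xp] := leP x p; [left|right]; split=> //; rewrite in_itv/= ?andbT.
rewrite ge0_muleDr//.
rewrite -(lebesgue_preimage_half (2^-1 * m2) mC1).
rewrite -(lebesgue_preimage_half (2^-1 * m1) mC2).
have mpre (a : R) (D : set R) : measurable D -> measurable [set x | D (2^-1 * x + a)%R].
  move=> mD.
  have : measurable_fun setT (fun x : R => 2^-1 * x + a)%R.
    by apply: measurable_funD => //; apply: measurable_funM.
  by move=> /(_ measurableT _ mD); rewrite setTI.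
apply: leeD.
  apply: le_measure; rewrite ?inE; [exact: compact_measurable|exact: mpre|].
  move=> x K1x /=; split.
    by rewrite -mulrDr; exact: K12C.
  by rewrite in_itv/= /p mulrDr lerD2r ler_pM2l ?invr_gt0//; exact: m1max.
have mK2 : measurable K2 by exact: compact_measurable.
have -> : leb K2 = leb (K2 `\ m2).
  rewrite -[in LHS](setD1K K2m2) measureU//; last 2 first.
  - exact: measurableD.
  - by apply/seteqP; split=> x //= [->] [].
  by rewrite -[X in X + _]/(leb [set m2]) lebesgue_measure_set1 add0e.
apply: le_measure; rewrite ?inE; [exact: measurableD|exact: mpre|].
move=> x [/= K2x /eqP xm2]; split.
  by rewrite -mulrDr addrC; exact: K12C.
rewrite in_itv/= andbT /p mulrDr addrC ltrD2r ltr_pM2l ?invr_gt0//.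
by rewrite lt_neqAle eq_sym xm2 m2min.
Qed.

(** Inner regularity; adjoining one point of A and one of B keeps the compact
    approximations nonempty. *)
Lemma brunn_minkowski1 (A B C : set R) :
  measurable A -> measurable B -> measurable C -> A !=set0 -> B !=set0 ->
  (forall x y, A x -> B y -> C (2^-1 * (x + y))%R) ->
  leb A + leb B <= 2%:E * leb C.
Proof.
move=> mA mB mC [a Aa] [b Bb] ABC.
have key K1 K2 : compact K1 -> K1 `<=` A -> compact K2 -> K2 `<=` B ->
    leb K1 + leb K2 <= 2%:E * leb C.
  move=> cK1 K1A cK2 K2B.
  have cK1' : compact (a |` K1) by apply: compactU => //; exact: compact_set1.
  have cK2' : compact (b |` K2) by apply: compactU => //; exact: compact_set1.
  apply: (@le_trans _ _ (leb (a |` K1) + leb (b |` K2))).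
    by apply: leeD; apply: le_measure; rewrite ?inE;
      try exact: compact_measurable; exact: subsetUr.
  apply: brunn_minkowski1_compact => //.
  - by exists a; left.
  - by exists b; left.
  - move=> x y [->|/K1A Ax] [->|/K2B By]; exact: ABC.
have [->|Cfin] := eqVneq (leb C) +oo.
  by rewrite mulry gtr0_sg// mul1e leey.
have C2fin : 2%:E * leb C \is a fin_num.
  by rewrite fin_numM// ge0_fin_numE// ltey.
have H2 K2 : compact K2 -> K2 `<=` B -> leb A + leb K2 <= 2%:E * leb C.
  move=> cK2 K2B.
  have fK2 : leb K2 \is a fin_num.
    by rewrite ge0_fin_numE//; exact: compact_finite_measure.
  rewrite -leeBrDr// (lebesgue_regularity_inner_sup mA).
  by apply: ge_ereal_sup => _ [K1 [cK1 K1A] <-]; rewrite leeBrDr//; exact: key.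
have fA : leb A \is a fin_num.
  rewrite ge0_fin_numE//; have := H2 set0 (@compact0 _) (@sub0set _ _).
  by rewrite measure0 adde0 => /le_lt_trans; apply; rewrite ltey_eq C2fin.
rewrite -leeBrDl// (lebesgue_regularity_inner_sup mB).
by apply: ge_ereal_sup => _ [K2 [cK2 K2B] <-]; rewrite leeBrDl//; exact: H2.
Qed.

(** For s < 1 the levels {f > s} and {g > s} are nonempty, and their half-sum
    lies in {h > s}; integrate the Brunn-Minkowski inequality over s.  The
    normalisation of both suprema to 1 is what makes the levels nonempty for
    the same range of s. *)
Let pl1_normalized (f g h : R -> \bar R) :
  measurable_fun setT f -> measurable_fun setT g -> measurable_fun setT h ->
  (forall x, 0 <= f x <= 1) -> (forall x, 0 <= g x <= 1) ->
  (forall x, 0 <= h x) ->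
  (forall s : R, (s < 1)%R -> exists x, s%:E < f x) ->
  (forall s : R, (s < 1)%R -> exists x, s%:E < g x) ->
  (forall x y, f x * g y <= h (2^-1 * (x + y))%R * h (2^-1 * (x + y))%R) ->
  \int[leb]_x f x + \int[leb]_x g x <= 2%:E * \int[leb]_x h x.
Proof.
move=> mf mg mh f01 g01 h0 fsup gsup fgh.
have f0 x : 0 <= f x by have /andP[] := f01 x.
have g0 x : 0 <= g x by have /andP[] := g01 x.
have [mlf ->] := layer_cake leb mf f0.
have [mlg ->] := layer_cake leb mg g0.
have [mlh ->] := layer_cake leb mh h0.
rewrite -ge0_integralD//; last 2 first.
- by move=> s _; case: ifP.
- by move=> s _; case: ifP.
rewrite -ge0_integralZl//; last by move=> s _; case: ifP.
apply: ge0_le_integral => //.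
- by move=> s _; case: ifP => // _; rewrite adde_ge0.
- exact: emeasurable_funD.
- exact: measurable_funeM.
move=> s _; case: ifPn => [s0|]; last by rewrite adde0 mule0.
have ml (u : R -> \bar R) : measurable_fun setT u -> measurable [set x | s%:E < u x].
  move=> mu; rewrite -[X in measurable X]setTI.
  exact: measurable_fun_lte.
have [s1|s1] := ltP s 1%R; last first.
  have e0 (u : R -> \bar R) : (forall x, 0 <= u x <= 1) -> leb [set x | s%:E < u x] = 0.
    move=> u01; rewrite (_ : [set x | _] = set0) ?measure0//.
    apply/seteqP; split=> x //=; have /andP[_ ux1] := u01 x.
    by apply/negP; rewrite -leNgt (le_trans ux1)// lee_fin.
  by rewrite [X in X + _](e0 f f01) [X in _ + X](e0 g g01) adde0 mule_ge0.
apply: brunn_minkowski1; [exact: ml|exact: ml|exact: ml|exact: fsup|exact: gsup|].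
move=> x y /= sf sg; rewrite ltNge; apply/negP => hs.
have := fgh x y; apply/negP; rewrite -ltNge.
apply: (@le_lt_trans _ _ (s%:E * s%:E)); first by apply: lee_pmul.
by apply: lte_pmul => //; rewrite lee_fin.
Qed.

(** Divide f, g, h by a = sup f, b = sup g and sqrt (a b), then use
    pq <= ((p + q) / 2)^2. *)
Let pl1_bounded (f g h : R -> \bar R) (k : R) :
  measurable_fun setT f -> measurable_fun setT g -> measurable_fun setT h ->
  (forall x, 0 <= f x <= k%:E) -> (forall x, 0 <= g x <= k%:E) ->
  (forall x, 0 <= h x) ->
  (forall x y, f x * g y <= h (2^-1 * (x + y))%R * h (2^-1 * (x + y))%R) ->
  (\int[leb]_x f x) * (\int[leb]_x g x) <= \int[leb]_x h x * \int[leb]_x h x.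
Proof.
move=> mf mg mh f0k g0k h0 fgh.
have supP (u : R -> \bar R) : (forall x, 0 <= u x <= k%:E) ->
    (forall x, u x = 0) \/ exists a : R, [/\ (0 < a)%R, forall x, u x <= a%:E &
      forall s : R, (s < 1)%R -> exists x, (s * a)%:E < u x].
  move=> u0k; have [u0|] := pselect (forall x, u x = 0); first by left.
  move=> /existsNP[x0 /eqP ux0]; right.
  have ub : ubound (range u) k%:E by move=> _ [x _ <-]; have /andP[] := u0k x.
  have sk : ereal_sup (range u) <= k%:E by exact: ge_ereal_sup.
  have s0 : 0 < ereal_sup (range u).
    apply: (@lt_le_trans _ _ (u x0)); last by apply: ereal_sup_ubound; exists x0.
    by rewrite lt_neqAle eq_sym ux0; have /andP[] := u0k x0.
  have sfin : ereal_sup (range u) \is a fin_num.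
    by rewrite ge0_fin_numE ?(ltW s0)// (le_lt_trans sk)// ltry.
  exists (fine (ereal_sup (range u))); split.
  - by rewrite -lte_fin fineK.
  - by move=> x; rewrite fineK//; apply: ereal_sup_ubound; exists x.
  move=> s s1.
  have : (s * fine (ereal_sup (range u)))%:E < ereal_sup (range u).
    rewrite -[ltRHS]fineK// lte_fin gtr_pMl//.
    by rewrite -lte_fin fineK.
  by move=> /ereal_sup_gt[_ [x _ <-] xs]; exists x.
have H0 : 0 <= \int[leb]_x h x * \int[leb]_x h x by rewrite mule_ge0// integral_ge0.
have [f0|[a [a0 fa asup]]] := supP f f0k.
  by rewrite [X in X * _]integral0_eq ?mul0e// => x _; exact: f0.
have [g0|[b [b0 gb bsup]]] := supP g g0k.
  by rewrite [X in _ * X]integral0_eq ?mule0// => x _; exact: g0.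
have fge0 x : 0 <= f x by have /andP[] := f0k x.
have gge0 x : 0 <= g x by have /andP[] := g0k x.
pose c := Num.sqrt (a * b)%R.
have c0 : (0 < c)%R by rewrite sqrtr_gt0 mulr_gt0.
have cc : (c * c = a * b)%R by rewrite -expr2 sqr_sqrtr// ltW// mulr_gt0.
have inv0 (d : R) : (0 < d)%R -> 0 <= d^-1%:E by move=> d0; rewrite lee_fin invr_ge0 ltW.
have norm01 (u : R -> \bar R) d : (0 < d)%R -> (forall x, 0 <= u x) ->
    (forall x, u x <= d%:E) -> forall x, 0 <= d^-1%:E * u x <= 1.
  move=> d0 u0 ud x; rewrite mule_ge0//= ?inv0//.
  by rewrite -(@mulVf _ d) ?gt_eqF// EFinM lee_pmul2l ?lte_fin ?invr_gt0.
have normsup (u : R -> \bar R) (d : R) : (0 < d)%R ->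
    (forall s : R, (s < 1)%R -> exists x, (s * d)%:E < u x) ->
    forall s : R, (s < 1)%R -> exists x, s%:E < d^-1%:E * u x.
  move=> d0 usup s /usup[x sx]; exists x.
  have -> : s%:E = d^-1%:E * (s * d)%:E by rewrite -EFinM mulrCA mulVf ?mulr1// gt_eqF.
  by rewrite lte_pmul2l ?lte_fin ?invr_gt0.
have main : \int[leb]_x (a^-1%:E * f x) + \int[leb]_x (b^-1%:E * g x) <=
    2%:E * \int[leb]_x (c^-1%:E * h x).
  apply: pl1_normalized.
  - exact: measurable_funeM.
  - exact: measurable_funeM.
  - exact: measurable_funeM.
  - exact: norm01.
  - exact: norm01.
  - by move=> x; rewrite mule_ge0 ?inv0.
  - exact: normsup.
  - exact: normsup.
  move=> x y; rewrite muleACA [leRHS]muleACA -!EFinM -!invfM cc.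
  apply: lee_pmul => //; last by rewrite mule_ge0.
  by rewrite lee_fin invr_ge0 mulr_ge0// ltW.
move: main; rewrite !ge0_integralZl ?inv0//.
have [->|Hfin] := eqVneq (\int[leb]_x h x) +oo.
  by move=> _; rewrite mulyy leey.
have {}Hfin : \int[leb]_x h x \is a fin_num.
  by rewrite ge0_fin_numE ?ltey// integral_ge0.
have F0 : 0 <= \int[leb]_x f x by exact: integral_ge0.
have G0 : 0 <= \int[leb]_x g x by exact: integral_ge0.
have HH0 : 0 <= \int[leb]_x h x by exact: integral_ge0.
move: F0 G0 HH0.
rewrite -(fineK Hfin).
move: (\int[leb]_x f x) (\int[leb]_x g x) (fine _) => F G H F0 G0.
rewrite lee_fin => HH0 main.
have afin : a^-1%:E * F \is a fin_num.
  rewrite ge0_fin_numE ?mule_ge0 ?inv0//.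
  apply: le_lt_trans (leeDl _ _) (le_lt_trans main _); first by rewrite mule_ge0 ?inv0.
  by rewrite -!EFinM ltry.
have bfin : b^-1%:E * G \is a fin_num.
  rewrite ge0_fin_numE ?mule_ge0 ?inv0//.
  apply: le_lt_trans (leeDr _ _) (le_lt_trans main _); first by rewrite mule_ge0 ?inv0.
  by rewrite -!EFinM ltry.
have rescale (d : R) (D : \bar R) : (0 < d)%R -> D = d%:E * (d^-1%:E * D).
  by move=> d0; rewrite muleA -EFinM mulfV ?mul1e ?gt_eqF.
rewrite (rescale a F)// (rescale b G)//.
move: main; rewrite -(fineK afin) -(fineK bfin).
set p := fine _; set q := fine _.
rewrite -!EFinM -EFinD !lee_fin => main.
rewrite mulrACA -cc.
have -> : (H * H = (c * c) * ((c^-1 * H) * (c^-1 * H)))%R.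
  by rewrite mulrACA !mulVKf// gt_eqF.
rewrite ler_pM2l ?mulr_gt0//.
have p0 : (0 <= p)%R by rewrite fine_ge0// mule_ge0// inv0.
have q0 : (0 <= q)%R by rewrite fine_ge0// mule_ge0// inv0.
move: main; set r := (c^-1 * H)%R => main.
have : (0 <= (p - q) ^+ 2)%R by exact: sqr_ge0.
by nra.
Qed.

(** Truncate f and g at height k and let k tend to infinity. *)
Let prekopa_leindler1 (f g h : R -> \bar R) :
  measurable_fun setT f -> measurable_fun setT g -> measurable_fun setT h ->
  (forall x, 0 <= f x) -> (forall x, 0 <= g x) -> (forall x, 0 <= h x) ->
  (forall x y, f x * g y <= h (2^-1 * (x + y))%R * h (2^-1 * (x + y))%R) ->
  (\int[leb]_x f x) * (\int[leb]_x g x) <= \int[leb]_x h x * \int[leb]_x h x.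
Proof.
move=> mf mg mh f0 g0 h0 fgh.
pose tr (u : R -> \bar R) (k : nat) x := mine (u x) k%:R%:E.
have mtr (u : R -> \bar R) k : measurable_fun setT u -> measurable_fun setT (tr u k).
  by move=> mu; exact: measurable_mine.
have tr0 (u : R -> \bar R) k : (forall x, 0 <= u x) -> forall x, 0 <= tr u k x <= k%:R%:E.
  by move=> u0 x; rewrite /tr le_min u0 lee_fin ler0n/= ge_min lexx orbT.
have trle (u : R -> \bar R) k x : tr u k x <= u x by rewrite /tr ge_min lexx.
have cvtr (u : R -> \bar R) : measurable_fun setT u -> (forall x, 0 <= u x) ->
    (\int[leb]_x tr u k x) @[k --> \oo] --> \int[leb]_x u x.
  move=> mu u0.
  have nd x : {homo (tr u)^~ x : m n / (m <= n)%N >-> m <= n}.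
    move=> m n mn; rewrite /tr le_min ge_min lexx/= ge_min.
    by rewrite lee_fin ler_nat mn orbT.
  have -> : \int[leb]_x u x = \int[leb]_x limn ((tr u)^~ x).
    apply: eq_integral => x _; apply/esym/cvg_lim => //.
    have := u0 x; rewrite /tr; case: (u x) => [r r0| _|//].
      apply: cvg_near_cst; near=> k; apply/min_idPl.
      by rewrite lee_fin; near: k; exact: nbhs_infty_ger.
    rewrite (_ : (fun k => _) = (fun k => k%:R%:E)).
      by apply/cvgenyP.
    by apply/funext => k; apply/min_idPr; exact: leey.
  apply: cvg_monotone_convergence => // [k|k x _].
    exact: mtr.
  by have /andP[] := tr0 u k u0 x.
have H0 : 0 <= \int[leb]_x h x * \int[leb]_x h x by rewrite mule_ge0// integral_ge0.
have [F0|F0] := eqVneq (\int[leb]_x f x) 0; first by rewrite F0 mul0e.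
have [G0|G0] := eqVneq (\int[leb]_x g x) 0; first by rewrite G0 mule0.
have /cvgeM : \int[leb]_x f x *? \int[leb]_x g x.
  by rewrite mule_defE (negbTE F0) (negbTE G0).
move=> /(_ _ _ _ _ _ (cvtr f mf f0) (cvtr g mg g0)) cv.
apply: cvge_le cv; apply: nearW => k.
apply: (@pl1_bounded _ _ _ k%:R) => //.
- exact: mtr.
- exact: mtr.
- exact: tr0.
- exact: tr0.
move=> x y; apply: le_trans (fgh x y).
by apply: lee_pmul => //; [have /andP[] := tr0 f k f0 x|have /andP[] := tr0 g k g0 y].
Unshelve. all: by end_near. Qed.

Lemma rV_cons_midpoint n (t u : R) (y z : 'rV[R]_n) :
  (2^-1 *: (rV_cons (t, y) + rV_cons (u, z)) =
   rV_cons ((2^-1 * (t + u))%R, 2^-1 *: (y + z)))%R.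
Proof.
apply/rowP => i; rewrite /rV_cons !mxE; case: splitP => j ij; rewrite !mxE//.
by rewrite (ord1 j) eqxx !mulr1n.
Qed.

(** Stated with products instead of square roots, so that infinite values are
    harmless: inner integrals of the induction on n may well be infinite. *)
Lemma prekopa_leindler n (f g h : 'rV[R]_n -> \bar R) :
  measurable_fun setT f -> measurable_fun setT g -> measurable_fun setT h ->
  (forall x, 0 <= f x) -> (forall x, 0 <= g x) -> (forall x, 0 <= h x) ->
  (forall x y, f x * g y <= h (2^-1 *: (x + y))%R * h (2^-1 *: (x + y))%R) ->
  (\int[lam n]_x f x) * (\int[lam n]_x g x) <=
  \int[lam n]_x h x * \int[lam n]_x h x.
Proof.
elim: n f g h => [|n IH] f g h mf mg mh f0 g0 h0 fgh.
  have i0 (u : 'rV[R]_0 -> \bar R) : measurable_fun setT u -> (forall x, 0 <= u x) ->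
      \int[lam 0]_x u x = u 0%R.
    by move=> mu u0; rewrite integral_dirac// diracT mul1e.
  rewrite !i0//; have := fgh 0%R 0%R.
  by rewrite addr0 scaler0.
rewrite (ge0_integral_rVS mf f0) (ge0_integral_rVS mg g0) (ge0_integral_rVS mh h0).
have ms (u : 'rV[R]_n.+1 -> \bar R) (t : R) : measurable_fun setT u ->
  measurable_fun setT (fun y => u (rV_cons (t, y))) by exact: measurable_section_rVS.
apply: prekopa_leindler1.
- exact: measurable_integral_rVS.
- exact: measurable_integral_rVS.
- exact: measurable_integral_rVS.
- by move=> t; exact: integral_ge0.
- by move=> t; exact: integral_ge0.
- by move=> t; exact: integral_ge0.
move=> t u; apply: IH => [|||||| y z].
- exact: ms.
- exact: ms.
- exact: ms.
- by [].
- by [].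
- by [].
by rewrite -rV_cons_midpoint; exact: fgh.
Qed.

End prekopa_leindler.

(** * Euclidean geometry of convex sets *)

Section euclid.
Context (R : realType) (n : nat).
Implicit Types (x y z u v : 'rV[R]_n) (A C : set 'rV[R]_n).

Definition dot x y : R := \sum_(i < n) x 0 i * y 0 i.

Lemma dotC x y : dot x y = dot y x.
Proof. by apply: eq_bigr => i _; rewrite mulrC. Qed.

Lemma dotDl x y z : dot (x + y) z = dot x z + dot y z.
Proof. by rewrite -big_split; apply: eq_bigr => i _; rewrite mxE mulrDl. Qed.

Lemma dotZl (c : R) x y : dot (c *: x) y = c * dot x y.
Proof. by rewrite /dot big_distrr/=; apply: eq_bigr => i _; rewrite mxE mulrA. Qed.

Lemma dotNl x y : dot (- x) y = - dot x y.
Proof. by rewrite -scaleN1r dotZl mulN1r. Qed.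

Lemma dotDr x y z : dot x (y + z) = dot x y + dot x z.
Proof. by rewrite dotC dotDl !(dotC _ x). Qed.

Lemma dotZr (c : R) x y : dot x (c *: y) = c * dot x y.
Proof. by rewrite dotC dotZl dotC. Qed.

Lemma dotNr x y : dot x (- y) = - dot x y.
Proof. by rewrite dotC dotNl dotC. Qed.

Definition dotE := (dotDl, dotDr, dotNl, dotNr, dotZl, dotZr).

Lemma dot_ge0 x : 0 <= dot x x.
Proof. by apply: sumr_ge0 => i _; rewrite -expr2 sqr_ge0. Qed.

Lemma coord_sqr_le_dot x i : x 0 i ^+ 2 <= dot x x.
Proof.
by rewrite /dot (bigD1 i)//= expr2 lerDl sumr_ge0// => j _; rewrite -expr2 sqr_ge0.
Qed.

Lemma dot_gt0 x : x != 0 -> 0 < dot x x.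
Proof.
move=> x0; rewrite lt_neqAle dot_ge0 andbT eq_sym; apply: contra x0 => /eqP d0.
apply/eqP/rowP => i; rewrite mxE; apply/eqP; rewrite -sqrf_eq0.
by rewrite eq_le sqr_ge0 andbT -d0 coord_sqr_le_dot.
Qed.

Lemma euclid_normE x : euclid_norm x = Num.sqrt (dot x x).
Proof. by congr Num.sqrt; apply: eq_bigr => i _; rewrite expr2. Qed.

Lemma euclid_norm_ge0 x : 0 <= euclid_norm x.
Proof. by rewrite euclid_normE sqrtr_ge0. Qed.

Lemma sqr_euclid_norm x : euclid_norm x ^+ 2 = dot x x.
Proof. by rewrite euclid_normE sqr_sqrtr// dot_ge0. Qed.

Lemma euclid_norm_le x (r : R) : 0 <= r -> (euclid_norm x <= r) = (dot x x <= r ^+ 2).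
Proof.
by move=> r0; rewrite -sqr_euclid_norm ler_pXn2r// nnegrE// euclid_norm_ge0.
Qed.

Lemma cauchy_schwarz x y : dot x y ^+ 2 <= dot x x * dot y y.
Proof.
have [->|y0] := eqVneq y 0.
  by rewrite -(scale0r 0) !dotZr !mul0r mulr0 expr0n.
have yy := dot_gt0 y0.
have := dot_ge0 (dot y y *: x - dot x y *: y).
rewrite !dotE (dotC y x); nra.
Qed.

Lemma dot_unit_le u x (r : R) : dot u u = 1 -> 0 <= r -> dot x x <= r ^+ 2 ->
  dot x u <= r.
Proof.
move=> uu r0 xr; apply: le_trans (ler_norm _) _.
rewrite -(@ler_pXn2r _ 2)// ?nnegrE// real_normK ?num_real//.
by apply: le_trans (cauchy_schwarz _ _) _; rewrite uu mulr1.
Qed.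

Lemma sqr_dist_continuous z : continuous (fun x => dot (x - z) (x - z)).
Proof.
apply: continuous_big => [|i _]; first exact: add_continuous.
have c : continuous (fun x : 'rV[R]_n => (x - z) 0 i).
  move=> x; rewrite (_ : (fun x => _) = fun x : 'rV[R]_n => x 0 i - z 0 i).
    by apply: continuousB; [exact: coord_continuous|exact: cst_continuous].
  by apply/funext => y; rewrite !mxE.
by move=> x; apply: continuousM; exact: c.
Qed.

Lemma measurable_dot u : measurable_fun setT (fun x => dot x u).
Proof.
apply: measurable_sum => i.
by apply: measurable_funM => //; exact: measurable_coord.
Qed.

Lemma closed_box_compact A (M : R) : closed A ->
  (forall x, A x -> forall i, `|x 0 i| <= M) -> compact A.
Proof.
move=> cA AM.
have cbox := @rV_compact R n (fun=> `[- M, M]%classic) (fun=> @segment_compact _ _ _).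
apply: subclosed_compact cA cbox _ => x Ax i /=.
by rewrite in_itv/= -ler_norml; exact: AM.
Qed.

Lemma closed_rV_measurable A : closed A -> measurable A.
Proof.
move=> cA; rewrite -(setCK A); apply: measurableC.
by apply: sub_sigma_algebra; exact: closed_openC.
Qed.

(** Convexity with the weight as a plain real, the form in which weights are
    computed below. *)
Definition segment_convex A := forall x y (t : R), 0 <= t <= 1 ->
  A x -> A y -> A (t *: x + (1 - t) *: y).

Lemma convex_set_segment A : convex_set A -> segment_convex A.
Proof.
move=> cA x y t /andP[t0 t1] Ax Ay.
have := cA x y (Itv01 t0 t1) (mem_set Ax) (mem_set Ay).
by rewrite inE.
Qed.

Lemma closure_segment_convex C : segment_convex C -> segment_convex (closure C).
Proof.
move=> cC x y t t01 Cx Cy B /nbhs_ballP[e/= e0 eB].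
have [x' [Cx' [_ xx']]] := Cx _ (nbhsx_ballx x _ e0).
have [y' [Cy' [_ yy']]] := Cy _ (nbhsx_ballx y _ e0).
exists (t *: x' + (1 - t) *: y'); split; first exact: cC.
apply: eB; split=> // i j; rewrite !mxE.
have {}xx' := xx' i j; have {}yy' := yy' i j.
rewrite /ball/= in xx' yy' *.
rewrite (_ : _ - _ = t * (x i j - x' i j) + (1 - t) * (y i j - y' i j)); last by ring.
move: t01 => /andP[t0 t1].
apply: le_lt_trans (ler_normD _ _) _; have t1' : 0 <= 1 - t by rewrite subr_ge0.
rewrite !normrM (ger0_norm t0) (ger0_norm t1') => {t1'}.
move: (`|x i j - x' i j|) (`|y i j - y' i j|) xx' yy' => a b ae be.
have [->|t1'] := eqVneq t 1; first by rewrite mul1r subrr mul0r addr0.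
have {t1'} t1 : t < 1 by rewrite lt_neqAle t1'.
by nra.
Qed.

(** Only a bounded part of C competes with a given point of C. *)
Lemma nearest_point C z : closed C -> C !=set0 ->
  exists2 p, C p & forall x, C x -> dot (p - z) (p - z) <= dot (x - z) (x - z).
Proof.
move=> clC [c Cc].
pose D := C `&` [set x | dot (x - z) (x - z) <= dot (c - z) (c - z)].
have clD : closed D.
  apply: closedI => //.
  rewrite -[X in closed X]/((fun x => dot (x - z) (x - z)) @^-1` [set r | r <= _]).
  by apply: preimage_closed (@closed_le _ _) => x _; exact: sqr_dist_continuous.
have cD : compact D.
  pose S := euclid_norm (c - z) + euclid_norm z.
  apply: (@closed_box_compact _ S) => // x [_ /= xD] i.
  have coordle (y : 'rV[R]_n) : `|y 0 i| <= euclid_norm y.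
    rewrite -(@ler_pXn2r _ 2)// ?nnegrE// ?euclid_norm_ge0//.
    by rewrite real_normK ?num_real// sqr_euclid_norm coord_sqr_le_dot.
  rewrite (_ : x 0 i = (x - z) 0 i + z 0 i); last by rewrite !mxE subrK.
  apply: le_trans (ler_normD _ _) _; apply: lerD => //.
  apply: le_trans (coordle _) _.
  by rewrite euclid_norm_le ?euclid_norm_ge0// sqr_euclid_norm.
have [||p /set_mem[Cp _] pmin] := @EVT_min_rV R n (fun x => dot (x - z) (x - z)) D _ cD.
- by exists c; split; rewrite //= lexx.
- by apply: continuous_subspaceT; exact: sqr_dist_continuous.
exists p => // x Cx.
have [xc|/ltW cx] := leP (dot (x - z) (x - z)) (dot (c - z) (c - z)).
  by apply: pmin; rewrite inE.
by apply: le_trans cx; apply: pmin; rewrite inE; split; rewrite //= lexx.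
Qed.

(** The first-order condition for moving from p towards x. *)
Lemma nearest_point_variational C z p : segment_convex C -> C p ->
  (forall x, C x -> dot (p - z) (p - z) <= dot (x - z) (x - z)) ->
  forall x, C x -> dot (x - p) (z - p) <= 0.
Proof.
move=> cC Cp pmin x Cx.
have key t : 0 < t <= 1 -> 2 * dot (x - p) (z - p) <= t * dot (x - p) (x - p).
  move=> /andP[t0 t1].
  have := pmin _ (cC x p t _ Cx Cp); rewrite (ltW t0) t1 => /(_ isT).
  have -> : t *: x + (1 - t) *: p - z = t *: (x - p) - (z - p).
    by apply/rowP => i; rewrite !mxE; ring.
  have -> : p - z = - (z - p) by rewrite opprB.
  move: (x - p) (z - p) => a b; rewrite !dotE (dotC b a) => h.
  by rewrite -(ler_pM2l t0); nra.
rewrite leNgt; apply/negP => d0.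
have xx := dot_ge0 (x - p).
pose t := Num.min 1 (dot (x - p) (z - p) / (dot (x - p) (x - p) + 1)).
have t0 : 0 < t by rewrite lt_min ltr01 divr_gt0// ltr_wpDl.
have := key t; rewrite t0/= ge_min lexx => /(_ isT).
have : t * (dot (x - p) (x - p) + 1) <= dot (x - p) (z - p).
  by rewrite -ler_pdivlMr ?ltr_wpDl// ge_min lexx orbT.
by nra.
Qed.

(** The third conclusion records how far z lies beyond the half-space:
    <z, u> = <p, u> + |z - p|. *)
Lemma separation_closed_convex C z : closed C -> segment_convex C -> C !=set0 ->
  ~ C z -> exists p u, [/\ C p, dot u u = 1, z = p + euclid_norm (z - p) *: u &
    forall x, C x -> dot x u <= dot p u].
Proof.
move=> clC cC C0 nCz.
have [p Cp pmin] := nearest_point z clC C0.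
have var := nearest_point_variational cC Cp pmin.
have zp : z - p != 0 by apply: contra_notN nCz => /eqP/subr0_eq ->.
have e0 : 0 < euclid_norm (z - p) by rewrite euclid_normE sqrtr_gt0 dot_gt0.
exists p, ((euclid_norm (z - p))^-1 *: (z - p)); split => //.
- by rewrite dotZl dotZr -sqr_euclid_norm; field; rewrite gt_eqF.
- by rewrite scalerA mulfV ?gt_eqF// scale1r addrC subrK.
move=> x Cx; rewrite !dotZr ler_pM2l ?invr_gt0//.
by rewrite -subr_ge0 -opprB -dotNl -dotDl oppr_ge0 var.
Qed.

(** C contains a point in each of the 2^n open orthants around v.  Segments
    between points on opposite sides of a coordinate hyperplane through v then
    produce, one coordinate at a time, points of C that agree with v on more and
    more coordinates. *)
Lemma interior_closure_convex C v (rho : R) : segment_convex C -> 0 < rho ->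
  ball v rho `<=` closure C -> C v.
Proof.
move=> cC rho0 vC.
have key (k : nat) (s : 'I_n -> bool) : exists2 c, C c & forall i : 'I_n,
    if (i < k)%N then c 0 i = v 0 i else if s i then v 0 i < c 0 i else c 0 i < v 0 i.
  elim: k s => [|k IH] s.
    pose w : 'rV[R]_n := \row_i (v 0 i + (if s i then rho / 2 else - (rho / 2))).
    have vw : ball v rho w.
      split=> // a i; rewrite (ord1 a) /ball/= mxE opprD addNKr normrN.
      case: ifP => _; rewrite ?normrN gtr0_norm ?divr_gt0//; lra.
    have r20 : 0 < rho / 2 by rewrite divr_gt0.
    have [c [Cc [_ wc]]] := vC _ vw _ (nbhsx_ballx w _ r20).
    exists c => // i; have := wc 0 i; rewrite /ball/= mxE ltr_norml => /andP[].
    by case: ifP => _; lra.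
  have [c1 Cc1 P1] := IH (fun i => if i == k :> nat then true else s i).
  have [c2 Cc2 P2] := IH (fun i => if i == k :> nat then false else s i).
  have [kn|nk] := ltnP k n; last first.
    by exists c1 => // i; have := P1 i; rewrite (leq_trans (ltn_ord i) nk) ltnS ltnW// (leq_trans (ltn_ord i) nk).
  have := P1 (Ordinal kn); have := P2 (Ordinal kn); rewrite /= ltnn eqxx => c2v c1v.
  set a := c1 0 (Ordinal kn) in c1v; set b := c2 0 (Ordinal kn) in c2v.
  pose t := (v 0 (Ordinal kn) - b) / (a - b).
  have ab : 0 < a - b by lra.
  have t0 : 0 < t by rewrite divr_gt0//; lra.
  have t1 : t < 1 by rewrite ltr_pdivrMr//; lra.
  exists (t *: c1 + (1 - t) *: c2); first by apply: cC => //; rewrite !ltW.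
  move=> i; rewrite !mxE; have := P1 i; have := P2 i.
  have [ik|ki|ik] := ltngtP (i : nat) k.
  - by rewrite ltnS (ltnW ik) => -> ->; ring.
  - rewrite ltnS leqNgt ki/=; case: ifP => _; nra.
  have -> : i = Ordinal kn by exact/val_inj.
  by rewrite /= ltnS leqnn => _ _; rewrite -/a -/b /t; field; lra.
have [c Cc cv] := key n (fun=> true).
suff <- : c = v by [].
by apply/rowP => i; have := cv i; rewrite ltn_ord.
Qed.

End euclid.

(** * The mass of a thin shell around a convex body *)

Section halfspaces.
Context (R : realType) (n : nat).
Implicit Types (A : set 'rV[R]_n).

(** The half-spaces supporting A at the nearest points of rational points
    outside A suffice: for z outside A, a rational point much closer to z than
    z is to A yields a half-space that still excludes z. *)
Lemma countable_halfspaces A : closed A -> segment_convex A -> A !=set0 ->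
  A <> setT -> exists (u : nat -> 'rV[R]_n) (h : nat -> R),
  [/\ forall k, dot (u k) (u k) = 1,
      forall k x, A x -> dot x (u k) <= h k &
      forall z, ~ A z -> exists k, h k < dot z (u k)].
Proof.
move=> clA cA A0 AT.
have [w0 nAw0] : exists w0, ~ A w0.
  by apply: contra_notP AT => /forallNP AT; apply/seteqP; split=> // x _; exact: contrapT (AT x).
pose rat_rV (q : 'rV[rat]_n) : 'rV[R]_n := \row_i ratr (q 0 i).
(* the indices that do not code an admissible rational point get w0 *)
pose w k : 'rV[R]_n := match @unpickle 'rV[rat]_n k with
  | Some q => if pselect (A (rat_rV q)) then w0 else rat_rV q
  | None => w0 end.
have nAw k : ~ A (w k).
  by rewrite /w; case: unpickle => // q; case: pselect.
have /choice[pu puP] : forall k, exists pu : 'rV[R]_n * 'rV[R]_n,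
    [/\ A pu.1, dot pu.2 pu.2 = 1, w k = pu.1 + euclid_norm (w k - pu.1) *: pu.2 &
    forall x, A x -> dot x pu.2 <= dot pu.1 pu.2].
  move=> k; have [p [u H]] := separation_closed_convex clA cA A0 (nAw k).
  by exists (p, u).
exists (fun k => (pu k).2), (fun k => dot (pu k).1 (pu k).2); split.
- by move=> k; have [] := puP k.
- by move=> k; have [] := puP k.
move=> z nAz.
have [rho /= rho0 zA] : exists2 rho : R, 0 < rho & ball z rho `<=` ~` A.
  by apply/nbhs_ballP; apply: open_nbhs_nbhs; split=> //; exact: closed_openC.
pose delta := rho / (4 * n.+1%:R).
have n1 : 0 < n.+1%:R :> R by rewrite ltr0n.
have delta0 : 0 < delta by rewrite divr_gt0// mulr_gt0.
have /choice[q qP] : forall i, exists q : rat, `|z 0 i - ratr q| < delta.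
  move=> i; have [q] : exists q : rat, ratr q \in `](z 0 i), (z 0 i + delta)[.
    by apply: rat_in_itvoo; rewrite ltrDl.
  rewrite in_itv/= => /andP[vr rv]; exists q.
  by rewrite distrC gtr0_norm ?subr_gt0// ltrBlDl.
pose qv : 'rV[rat]_n := \row_i q i.
have zq i : `|z 0 i - rat_rV qv 0 i| < delta by rewrite !mxE.
have deltarho : delta <= rho / 4.
  by rewrite /delta invfM mulrA ler_pdivrMr// ler_peMr ?divr_ge0 ?(ltW rho0)// ler1n.
have wk : w (pickle qv) = rat_rV qv.
  rewrite /w pickleK; case: pselect => // Aq; exfalso.
  apply: zA Aq; split=> // a i; rewrite (ord1 a); apply: lt_le_trans (zq i) _; lra.
exists (pickle qv); have [Ap uu wE _] := puP (pickle qv).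
move: Ap uu wE; rewrite wk; move: (pu _).1 (pu _).2 => p u Ap uu wE.
have zw : dot (z - rat_rV qv) (z - rat_rV qv) <= (rho / 4) ^+ 2.
  apply: (@le_trans _ _ (\sum_(i < n) delta ^+ 2)).
    apply: ler_sum => i _; have := zq i; rewrite !mxE ltr_norml => /andP[]; nra.
  rewrite sumr_const card_ord -[_ *+ n]mulr_natr.
  apply: (@le_trans _ _ (delta ^+ 2 * n.+1%:R ^+ 2)).
    rewrite ler_wpM2l ?sqr_ge0// -natrX ler_nat.
    by rewrite (leq_trans (leqnSn n))// -[leqLHS]muln1 leq_mul.
  by rewrite -exprMn /delta (_ : rho / _ * _ = rho / 4)//; field; rewrite !gt_eqF.
rewrite ltNge; apply/negP => hz.
set e := euclid_norm (rat_rV qv - p) in wE.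
have e0 : 0 <= e by exact: euclid_norm_ge0.
have ez : e <= rho / 4.
  have : dot (rat_rV qv - z) u <= rho / 4.
    by apply: dot_unit_le => //; [lra|rewrite -opprB dotNl dotNr opprK].
  rewrite dotDl dotNl wE dotDl dotZl uu mulr1; lra.
have : dot (z - p) (z - p) < rho ^+ 2.
  have -> : z - p = (z - rat_rV qv) + e *: u.
    by rewrite {1}wE opprD addrA subrK.
  have := dot_ge0 ((z - rat_rV qv) - e *: u).
  move: (z - _) zw => a aa.
  rewrite !dotE (dotC u a) uu; nra.
apply/negP; rewrite -leNgt.
have [i zi] : exists i, rho <= `|z 0 i - p 0 i|.
  apply: contrapT => /forallNP H; apply: zA Ap; split=> // a i.
  by rewrite (ord1 a) /ball/= ltNge; exact/negP.
apply: le_trans (coord_sqr_le_dot _ i).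
by rewrite -[leRHS]real_normK ?num_real// !mxE ler_pXn2r// nnegrE ltW.
Qed.

End halfspaces.

Section measurable_comparison.
Context d (T : measurableType d) (R : realType).

Lemma measurable_ltr_set (f g : T -> R) :
  measurable_fun setT f -> measurable_fun setT g ->
  measurable [set x | f x < g x].
Proof.
move=> mf mg; rewrite -[X in measurable X]setTI.
by apply: (@measurable_lte _ _ _ _ _ (EFin \o f) (EFin \o g)) => //;
  exact/measurable_EFinP.
Qed.

Lemma measurable_ler_set (f g : T -> R) :
  measurable_fun setT f -> measurable_fun setT g ->
  measurable [set x | f x <= g x].
Proof.
move=> mf mg; rewrite -[X in measurable X]setTI.
by apply: (@measurable_lee _ _ _ _ _ (EFin \o f) (EFin \o g)) => //;
  exact/measurable_EFinP.
Qed.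

End measurable_comparison.

Lemma bernoulli_onem (R : realType) (n : nat) (s : R) : 0 <= s <= 1 ->
  1 - n%:R * s <= (1 - s) ^+ n.
Proof.
move=> /andP[s0 s1]; elim: n => [|n IH]; first by rewrite mul0r subr0 expr0.
rewrite exprS; apply: (@le_trans _ _ ((1 - s) * (1 - n%:R * s))).
  have n0 : 0 <= n%:R :> R by [].
  rewrite -natr1; nra.
by rewrite ler_wpM2l// subr_ge0.
Qed.

Section parallel.
Context (R : realType) (n : nat).
Implicit Types (A : set 'rV[R]_n) (h eps : R).

Lemma parallel_body_halfspace A (u : 'rV[R]_n) h eps x : dot u u = 1 -> 0 <= eps ->
  (forall y, A y -> dot y u <= h) -> parallel_body A eps x -> dot x u <= h + eps.
Proof.
move=> u1 eps0 Ah [a Aa [y yB <-]]; rewrite dotDl dotZl lerD ?Ah// ler_piMr//.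
apply: dot_unit_le => //; rewrite expr1n.
by have := yB; rewrite /euclid_ball/= euclid_norm_le// expr1n.
Qed.

Lemma sub_parallel_body A eps : A `<=` parallel_body A eps.
Proof.
move=> x Ax; exists x => //; exists 0; last by rewrite scaler0 addr0.
by rewrite /euclid_ball/= euclid_norm_le// -(scale0r 0) dotZl mul0r expr1n.
Qed.

Lemma closed_euclid_ball : closed (@euclid_ball R n).
Proof.
rewrite (_ : @euclid_ball R n = (fun x => dot (x - 0) (x - 0)) @^-1` [set t | t <= 1]).
  by apply: preimage_closed (@closed_le _ _) => x _; exact: sqr_dist_continuous.
by apply/seteqP; split=> x; rewrite /euclid_ball/= subr0 euclid_norm_le// expr1n.
Qed.

Lemma compact_euclid_ball : compact (@euclid_ball R n).
Proof.
apply: (@closed_box_compact _ _ _ 1); first exact: closed_euclid_ball.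
move=> x; rewrite /euclid_ball/= euclid_norm_le// expr1n => x1 i.
rewrite -(@ler_pXn2r _ 2)// ?nnegrE// real_normK ?num_real// expr1n.
exact: le_trans (coord_sqr_le_dot _ _) x1.
Qed.

Lemma compact_parallel_body A eps : compact A -> compact (parallel_body A eps).
Proof.
move=> cA; pose phi (p : 'rV[R]_n * 'rV[R]_n) := p.1 + eps *: p.2.
rewrite (_ : parallel_body A eps = phi @` (A `*` @euclid_ball R n)).
  apply: continuous_compact; last exact: compact_setX cA compact_euclid_ball.
  apply: continuous_subspaceT => p; apply: cvgD; first exact: cvg_fst.
  by apply: cvgZ; [exact: cvg_cst|exact: cvg_snd].
apply/seteqP; split=> [x [a Aa [y yB <-]]|x [[a y] [/= Aa yB] <-]].
  by exists (a, y).
by exists a => //; exists y.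
Qed.

End parallel.

Section shell.
Context (R : realType) (n : nat).
Local Notation lam := (lebesgue_rV R n).
Variable F : 'rV[R]_n -> R.
Hypothesis mF : measurable_fun setT F.
Hypothesis F0 : forall x, 0 <= F x.
Hypothesis F1 : (\int[lam]_x (F x)%:E = 1)%E.
Variables D r : R.
Hypotheses (D0 : 0 <= D) (r0 : 0 < r).
(* the log-concave interpolation of: F drops by a factor of at most exp D from
   any point to any point of the ball of radius r *)
Hypothesis star : forall v x (s : R), dot v v <= r ^+ 2 -> 0 <= s <= 1 ->
  expR (- (s * D)) * F x <= F ((1 - s) *: x + s *: v).

Section cells.
Variables (N : nat) (u : 'I_N -> 'rV[R]_n) (h : 'I_N -> R).
Hypothesis uu : forall j, dot (u j) (u j) = 1.

(* signed excess of x over the j-th constraint *)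
Let exc j x := dot x (u j) - h j.

(** Points whose most violated constraint is the j-th one; ties go to the
    smallest index, which makes the cells disjoint. *)
Let cell j : set 'rV[R]_n := [set x | 0 < exc j x] `&`
  \bigcap_(i in [set: 'I_N]) [set x | exc i x <= exc j x /\
     ((i < j)%N -> exc i x < exc j x)].

Let measurable_exc j : measurable_fun setT (exc j).
Proof. by apply: measurable_funB => //; exact: measurable_dot. Qed.

Let measurable_cell j : measurable (cell j).
Proof.
apply: measurableI.
  by apply: measurable_ltr_set => //; exact: measurable_exc.
apply: fin_bigcap_measurable => // i _.
case: (ltnP i j) => ij.
  rewrite (_ : [set x | _] = [set x | exc i x < exc j x]).
    by apply: measurable_ltr_set; exact: measurable_exc.
  by apply/seteqP; split=> [x [_ /(_ isT)]//|x /= xij]; split=> //; exact: ltW.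
rewrite (_ : [set x | _] = [set x | exc i x <= exc j x]).
  by apply: measurable_ler_set; exact: measurable_exc.
by apply/seteqP; split=> [x []//|x /= xij].
Qed.

Let cell_uniq i j x : cell i x -> cell j x -> i = j.
Proof.
move=> [_ /= ci] [_ /= cj].
have [ij|ji|/val_inj//] := ltngtP i j.
  by exfalso; have [_ /(_ ij)] := cj i I; have [] := ci j I; lra.
by exfalso; have [_ /(_ ji)] := ci j I; have [] := cj i I; lra.
Qed.

Let cell_ex j x : 0 < exc j x -> exists i, cell i x.
Proof.
move=> jx.
have [m _ mmax] := @arg_maxP _ R 'I_N j xpredT (exc^~ x) isT.
pose P i := exc m x <= exc i x.
have Pm : P m by rewrite /P lexx.
have [i Pi imin] := @arg_minnP 'I_N m P (fun i => i : nat) Pm.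
exists i; split; first by apply: lt_le_trans jx _; apply: le_trans (mmax j isT) _.
move=> k _ /=; split; first by apply: le_trans (mmax k isT) _.
move=> ki; rewrite ltNge; apply/negP => ik.
have : P k by apply: le_trans Pi ik.
by move=> /imin; rewrite leqNgt ki.
Qed.

Variable eps : R.
Hypothesis eps0 : 0 < eps.

Let exc_shift i j x : exc i (x - eps *: u j) = exc i x - eps * dot (u j) (u i).
Proof. by rewrite /exc dotDl dotNl dotZl; ring. Qed.

Let dot_uu_le i j : dot (u j) (u i) <= 1.
Proof. by apply: dot_unit_le => //; rewrite uu expr1n. Qed.

(** Moving outward by eps along u_j raises the j-th excess by eps and every
    other one by eps <u_j, u_i> <= eps, so the j-th constraint stays the most
    violated one. *)
Let cell_shift j x : cell j (x - eps *: u j) -> cell j x /\ eps < exc j x.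
Proof.
move=> [/= c0 cj].
rewrite exc_shift uu mulr1 in c0.
have ej : eps < exc j x by rewrite -subr_gt0.
split=> //; split=> [|i _]; first by apply: lt_trans eps0 ej.
have [] := cj i I; rewrite !exc_shift uu mulr1 => h1 h2.
have h3 : eps * dot (u j) (u i) <= eps by rewrite ler_piMr// ?dot_uu_le// ltW.
split; first by lra.
by move=> /h2; lra.
Qed.

Let ind (S : set 'rV[R]_n) x : R := \1_S x.

Let T : set 'rV[R]_n :=
  [set x | (exists j, 0 < exc j x) /\ forall j, exc j x <= eps].
Let U : set 'rV[R]_n := [set x | exists j, 0 < exc j x].

(** The shell T and the shifted cells are disjoint subsets of the exterior U. *)
Let shift_ineq x :
  F x * ind T x + \sum_(j < N) F x * ind (cell j) (x - eps *: u j) <= F x * ind U x.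
Proof.
have TU : ind T x <= ind U x.
  rewrite /ind !indicE ler_nat; case: (boolP (x \in T)) => //.
  by rewrite inE => -[Ux _]; rewrite mem_set.
have [[j cj]|nc] := pselect (exists j, cell j (x - eps *: u j)); last first.
  rewrite big1 ?addr0 ?ler_wpM2l// => j _.
  by rewrite /ind indicE memNset ?mulr0// => cj; apply: nc; exists j.
have [cjx ejx] := cell_shift cj.
rewrite (bigD1 j)//= big1 => [|i ij]; last first.
  rewrite /ind indicE memNset ?mulr0// => /cell_shift[cix _].
  by move: ij; rewrite (cell_uniq cix cjx) eqxx.
rewrite /ind !indicE (mem_set cj) (mem_set (_ : U x)); last by exists j; have [] := cjx.
by rewrite memNset ?mulr0 ?add0r ?addr0// => -[_ /(_ j)]; lra.
Qed.

Hypothesis eps_r : eps < r.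
Let s := eps / r.
Let k := expR (- (s * D)).

Let s01 : 0 < s < 1.
Proof. by rewrite divr_gt0//= ltr_pdivrMr// mul1r. Qed.

(** x + eps v is the mean of x / (1 - s) and r v with weights 1 - s and s. *)
Let shrink x v : dot v v = 1 -> k * F ((1 - s)^-1 *: x) <= F (x + eps *: v).
Proof.
move=> v1; have /andP[s0 s1] := s01.
have := @star (r *: v) ((1 - s)^-1 *: x) s; rewrite !dotE v1 !mulr1 -expr2.
rewrite lexx (ltW s0) (ltW s1) => /(_ isT isT); rewrite !scalerA.
rewrite mulfV ?scale1r ?subr_eq0 ?gt_eqF// (_ : s * r = eps)//.
by rewrite /s mulfVK// gt_eqF.
Qed.

Let shrink0 x : k * F ((1 - s)^-1 *: x) <= F x.
Proof.
have /andP[s0 s1] := s01.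
have := @star 0 ((1 - s)^-1 *: x) s.
rewrite -{1 2}(scale0r 0) dotZl mul0r sqr_ge0 (ltW s0) (ltW s1) => /(_ isT isT).
by rewrite scaler0 addr0 scalerA mulfV ?scale1r// subr_eq0 gt_eqF.
Qed.

Let measurable_U : measurable U.
Proof.
rewrite (_ : U = \bigcup_(j in [set: 'I_N]) [set x | 0 < exc j x]).
  apply: fin_bigcup_measurable => // j _.
  by apply: measurable_ltr_set => //; exact: measurable_exc.
by apply/seteqP; split=> x [j]; [exists j|move=> _ ?; exists j].
Qed.

Let measurable_T : measurable T.
Proof.
rewrite (_ : T = U `&` \bigcap_(j in [set: 'I_N]) [set x | exc j x <= eps]).
  apply: measurableI => //; apply: fin_bigcap_measurable => // j _.
  by apply: measurable_ler_set => //; exact: measurable_exc.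
by apply/seteqP; split=> x [Ux Hx]; split=> // j; [move=> _; exact: Hx|exact: Hx].
Qed.

Let sum_cells x : \sum_(j < N) ind (cell j) x = ind U x.
Proof.
have [[j cj]|nc] := pselect (exists j, cell j x).
  rewrite (bigD1 j)//= big1 ?addr0 => [|i ij]; last first.
    rewrite /ind indicE memNset// => ci.
    by move: ij; rewrite (cell_uniq ci cj) eqxx.
  by rewrite /ind !indicE (mem_set cj) mem_set//; exists j; have [] := cj.
rewrite big1 => [|j _]; last by rewrite /ind indicE memNset// => cj; apply: nc; exists j.
by rewrite /ind indicE memNset// => -[j /cell_ex].
Qed.

Let mFi (g : 'rV[R]_n -> R) (S : set 'rV[R]_n) : measurable_fun setT g -> measurable S ->
  measurable_fun setT (fun x => (g x * ind S x)%:E).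
Proof.
move=> mg mS; apply/measurable_EFinP; apply: measurable_funM => //.
exact: measurable_indic.
Qed.

Let ind_ge0 S x : 0 <= ind S x. Proof. by rewrite /ind. Qed.

Let G x := F ((1 - s)^-1 *: x).

Let mscale_fun (c : R) : measurable_fun setT (fun x : 'rV[R]_n => F (c *: x)).
Proof.
rewrite (_ : (fun x => _) = F \o (fun x : 'rV[R]_n => c *: x + 0)).
  by apply: (measurableT_comp mF); exact: measurable_affine.
by apply/funext => x /=; rewrite addr0.
Qed.

Let mG : measurable_fun setT G. Proof. exact: mscale_fun. Qed.

Let G0 x : 0 <= G x. Proof. exact: F0. Qed.

Let integral_G : (\int[lam]_x (G x)%:E = ((1 - s) ^+ n)%:E)%E.
Proof.
have /andP[s0 s1] := s01.
have c0 : 0 < (1 - s)^-1 by rewrite invr_gt0 subr_gt0.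
have mFE : measurable_fun setT (fun x => (F x)%:E) by exact/measurable_EFinP.
have := @ge0_integral_affine R n (fun x => (F x)%:E) _ 0 c0 mFE (fun x => F0 x).
rewrite F1 mule1 exprVn invrK => <-.
by apply: eq_integral => x _; rewrite addr0.
Qed.

Let integral_shift j :
  (\int[lam]_x (F x * ind (cell j) (x - eps *: u j))%:E =
   \int[lam]_x (F (x + eps *: u j) * ind (cell j) x)%:E)%E.
Proof.
pose g x := (F x * ind (cell j) (x - eps *: u j))%:E.
have mg : measurable_fun setT g.
  apply/measurable_EFinP; apply: measurable_funM => //.
  have mi : measurable_fun setT (ind (cell j)) by exact: measurable_indic.
  apply: (measurableT_comp mi).
  rewrite (_ : (fun x => _) = fun x : 'rV[R]_n => 1 *: x + - (eps *: u j)).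
    exact: measurable_affine.
  by apply/funext => x; rewrite scale1r.
have g0 x : (0 <= g x)%E by rewrite lee_fin mulr_ge0.
have := ge0_integral_affine (eps *: u j) ltr01 mg g0.
rewrite expr1n invr1 mul1e => <-.
by apply: eq_integral => x _; rewrite /g scale1r addrK.
Qed.

(** Integrating shift_ineq bounds the mass of the shell plus k times the
    integral of F (x / (1 - s)) over the exterior by the mass of the exterior;
    inside the polytope shrink0 gives the same comparison.  Altogether the mass
    of the shell is at most 1 - k (1 - s)^n. *)
Let shell_T :
  (\int[lam]_x (F x * ind T x)%:E <= (s * (D + n%:R))%:E)%E.
Proof.
have /andP[s0 s1] := s01.
have k0 : 0 <= k by exact: expR_ge0.
have mcell_shift j : measurable_fun setT
    (fun x : 'rV[R]_n => (F x * ind (cell j) (x - eps *: u j))%:E).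
  apply/measurable_EFinP; apply: measurable_funM => //.
  have mi : measurable_fun setT (ind (cell j)) by exact: measurable_indic.
  apply: (measurableT_comp mi).
  rewrite (_ : (fun x => _) = fun x : 'rV[R]_n => 1 *: x + - (eps *: u j)).
    exact: measurable_affine.
  by apply/funext => x; rewrite scale1r.
have mkG : measurable_fun setT (fun x => k * G x) by exact: measurable_funM.
have kG0 x : 0 <= k * G x by exact: mulr_ge0.
have step1 : (\int[lam]_x (F x * ind T x)%:E +
    \sum_(j < N) \int[lam]_x (F x * ind (cell j) (x - eps *: u j))%:E <=
    \int[lam]_x (F x * ind U x)%:E)%E.
  rewrite -ge0_integral_sum//; last by move=> j x _; rewrite lee_fin mulr_ge0.
  rewrite -ge0_integralD//; last 4 first.
  - by move=> x _; rewrite lee_fin mulr_ge0.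
  - exact: mFi.
  - by move=> x _; apply: sume_ge0 => j _; rewrite lee_fin mulr_ge0.
  - exact: emeasurable_sum.
  apply: ge0_le_integral => //.
  - move=> x _; apply: adde_ge0; first by rewrite lee_fin mulr_ge0.
    by apply: sume_ge0 => j _; rewrite lee_fin mulr_ge0.
  - by apply: emeasurable_funD; [exact: mFi|exact: emeasurable_sum].
  - exact: mFi.
  - by move=> x _; rewrite sumEFin -EFinD lee_fin; exact: shift_ineq.
have step2 : (\int[lam]_x (k * G x * ind U x)%:E <=
    \sum_(j < N) \int[lam]_x (F x * ind (cell j) (x - eps *: u j))%:E)%E.
  rewrite (eq_integral (fun x => \sum_(j < N) (k * G x * ind (cell j) x)%:E)%E); last first.
    by move=> x _; rewrite sumEFin -mulr_sumr sum_cells.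
  rewrite ge0_integral_sum//; last 2 first.
  - by move=> j; exact: mFi.
  - by move=> j x _; rewrite lee_fin mulr_ge0.
  apply: lee_sum => j _; rewrite integral_shift.
  apply: ge0_le_integral => //.
  - by move=> x _; rewrite lee_fin mulr_ge0.
  - exact: mFi.
  - apply: mFi => //; apply: (measurableT_comp mF).
    rewrite (_ : (fun x => _) = fun x : 'rV[R]_n => 1 *: x + eps *: u j).
      exact: measurable_affine.
    by apply/funext => x; rewrite scale1r.
  - by move=> x _; rewrite lee_fin ler_wpM2r// shrink.
have step3 : (\int[lam]_x (k * G x * ind (~` U) x)%:E <=
    \int[lam]_x (F x * ind (~` U) x)%:E)%E.
  apply: ge0_le_integral => //.
  - by move=> x _; rewrite lee_fin mulr_ge0.
  - by apply: mFi => //; exact: measurableC.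
  - by apply: mFi => //; exact: measurableC.
  - by move=> x _; rewrite lee_fin ler_wpM2r// shrink0.
have split (g : 'rV[R]_n -> R) : measurable_fun setT g -> (forall x, 0 <= g x) ->
    (\int[lam]_x (g x)%:E =
     \int[lam]_x (g x * ind U x)%:E + \int[lam]_x (g x * ind (~` U) x)%:E)%E.
  move=> mg g0; rewrite -ge0_integralD//; last 4 first.
  - by move=> x _; rewrite lee_fin mulr_ge0.
  - exact: mFi.
  - by move=> x _; rewrite lee_fin mulr_ge0.
  - by apply: mFi => //; exact: measurableC.
  apply: eq_integral => x _; rewrite -EFinD -mulrDr /ind !indicE in_setC.
  by case: (x \in U); rewrite ?addr0 ?add0r mulr1.
have : (\int[lam]_x (F x * ind T x)%:E + \int[lam]_x (k * G x)%:E <= 1)%E.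
  rewrite -F1 (split F)// (split (fun x => k * G x))// addeA.
  by apply: leeD => //; apply: le_trans step1; exact: leeD2l.
have -> : (\int[lam]_x (k * G x)%:E = (k * (1 - s) ^+ n)%:E)%E.
  under eq_integral do rewrite EFinM.
  have mGE : measurable_fun setT (fun x => (G x)%:E) by exact/measurable_EFinP.
  rewrite (ge0_integralZl _ measurableT mGE) ?integral_G//.
  by move=> x _; rewrite lee_fin G0.
rewrite -leeBrDr// => /le_trans; apply.
rewrite -EFinB lee_fin.
have : 1 - s * D <= k by apply: le_trans (expR_ge1Dx _); rewrite lexx.
have : k <= 1 by rewrite -expR0 ler_expR oppr_le0 mulr_ge0// ltW.
have := @bernoulli_onem R n s; rewrite (ltW s0) (ltW s1) => /(_ isT).
have : 0 <= (1 - s) ^+ n <= 1.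
  by rewrite exprn_ge0 ?exprn_ile1// ?subr_ge0 ?gerBl ltW.
move: (_ ^+ n) k k0 => y k' k'0 /andP[y0 y1]; nra.
Qed.

Lemma shell_polytope (S : set 'rV[R]_n) : measurable S ->
  (forall x, S x -> (exists j, h j < dot x (u j)) /\
                    forall j, dot x (u j) <= h j + eps) ->
  (\int[lam]_(x in S) (F x)%:E <= (eps / r * (D + n%:R))%:E)%E.
Proof.
move=> mS ST; apply: le_trans shell_T.
rewrite integral_mkcond; apply: ge0_le_integral => //.
- by move=> x _; apply: erestrict_ge0 => y _; rewrite lee_fin.
- apply/(measurable_restrictT _ _).1 => //; apply: measurable_funS measurableT _ _ => //.
  exact/measurable_EFinP.
- exact: mFi.
move=> x _; rewrite patchE; case: ifPn => [|_]; last by rewrite lee_fin mulr_ge0.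
rewrite inE => /ST[[j jx] xj].
rewrite lee_fin /ind indicE mem_set ?mulr1//; split.
  by exists j; rewrite subr_gt0.
by move=> i; rewrite lerBlDl.
Qed.

End cells.

(** The finite subfamilies of the half-spaces cutting out A exhaust the shell,
    and the bound for a polytope does not depend on the number of facets. *)
Lemma shell_measure_le (A : set 'rV[R]_n) eps : 0 < eps < r ->
  compact A -> segment_convex A -> A !=set0 ->
  (\int[lam]_(x in parallel_body A eps `\` A) (F x)%:E <=
   (eps / r * (D + n%:R))%:E)%E.
Proof.
move=> /andP[eps0 epsr] cA convA A0.
have clA : closed A by apply: compact_closed => //; exact: norm_hausdorff.
have clP : closed (parallel_body A eps).
  by apply: compact_closed; [exact: norm_hausdorff|exact: compact_parallel_body].
have mA := closed_rV_measurable clA; have mP := closed_rV_measurable clP.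
have [AT|AT] := pselect (A = setT).
  rewrite AT setDT integral_set0 lee_fin mulr_ge0//.
    by rewrite divr_ge0// ltW.
  by rewrite addr_ge0.
have [u [h [u1 Ah hA]]] := countable_halfspaces clA convA A0 AT.
pose B N := parallel_body A eps `&` \bigcup_(k in `I_N) [set x | h k < dot x (u k)].
have mB N : measurable (B N).
  apply: measurableI => //; apply: fin_bigcup_measurable => // k _.
  by apply: measurable_ltr_set => //; exact: measurable_dot.
have BE : parallel_body A eps `\` A = \bigcup_N B N.
  apply/seteqP; split=> [x [Px /hA[k kx]]|x [N _ [Px [k _ /= kx]]]].
    by exists k.+1 => //; split=> //; exists k => /=.
  by split=> // /(Ah k); rewrite leNgt kx.
have ndB : nondecreasing_seq B.
  move=> m N mN; apply/subsetPset => x [Px [k /= km kx]]; split=> //.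
  by exists k => //=; exact: leq_trans mN.
have mFE : measurable_fun setT (EFin \o F) by exact/measurable_EFinP.
have mfB N : measurable_fun (B N) (EFin \o F) by exact: measurable_funS mFE.
have fB0 N x : B N x -> (0 <= (EFin \o F) x)%E by move=> _; rewrite lee_fin.
have cv := @ge0_nondecreasing_set_cvg_integral _ _ _ _ _ lam ndB mB mfB fB0.
rewrite BE; apply: cvge_le cv; apply: nearW => N.
apply: (@shell_polytope N (fun i => u i) (fun i => h i)) => // x [Px [k /= kN kx]].
split; first by exists (Ordinal kN).
move=> j; apply: parallel_body_halfspace Px => //; first exact: ltW.
exact: Ah.
Qed.

(** The quotient is at most (D + n) / r for every eps < r. *)
Lemma perimeter_le (mu : probability 'rV[R]_n R) (A : set 'rV[R]_n) :
  (forall B, measurable B -> mu B = (\int[lam]_(x in B) (F x)%:E)%E) ->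
  convex_body A -> (perimeter mu A <= ((D + n%:R) / r)%:E)%E.
Proof.
move=> muE [cA convA A0].
have clA : closed A by apply: compact_closed => //; exact: norm_hausdorff.
have mA := closed_rV_measurable clA.
have mP eps : measurable (parallel_body A eps).
  apply: closed_rV_measurable; apply: compact_closed; first exact: norm_hausdorff.
  exact: compact_parallel_body.
have An0 : A !=set0 by have [x /interior_subset Ax] := A0; exists x.
rewrite /perimeter limf_einfE; apply: ge_ereal_sup => _ [V V0 <-].
have [eps [Veps eps0 epsr]] : exists eps, [/\ V eps, 0 < eps & eps < r].
  have : \forall e \near 0^'+, V e /\ 0 < e < r.
    near=> e; split; first by near: e.
    by apply/andP; split; near: e; [exact: nbhs_right_gt|exact: nbhs_right_lt].
  by move=> /filter_ex[e [Ve /andP[]]]; exists e.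
apply: (@le_trans _ _ ((mu (parallel_body A eps) - mu A) * eps^-1%:E)%E).
  by apply: ereal_inf_lbound; exists eps.
have <- : mu (parallel_body A eps `\` A) = (mu (parallel_body A eps) - mu A)%E.
  rewrite measureD// ?setIidr//; first exact: sub_parallel_body.
  by rewrite (le_lt_trans (probability_le1 _ _))// ltry.
rewrite muE; last exact: measurableD.
have := @shell_measure_le A eps _ cA (convex_set_segment convA) An0.
rewrite eps0 epsr => /(_ isT).
rewrite -lee_pdivlMr ?invr_gt0// -EFinM => /le_trans; apply.
by rewrite lee_fin invrK le_eqVlt; apply/orP; left; apply/eqP; field; rewrite gt_eqF.
Unshelve. all: by end_near. Qed.

End shell.

(** * One-dimensional marginals of an isotropic density *)

Section reverse_hoelder.
Context (R : realType) (n : nat).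
Local Notation lam := (lebesgue_rV R n).
Variable F : 'rV[R]_n -> R.
Hypothesis mF : measurable_fun setT F.
Hypothesis F0 : forall x, 0 <= F x.
Hypothesis F1 : (\int[lam]_x (F x)%:E = 1)%E.
Hypothesis lc : forall x y (t p q : R), 0 <= t <= 1 ->
  expR (- p) <= F x -> expR (- q) <= F y ->
  expR (- (t * p + (1 - t) * q)) <= F (t *: x + (1 - t) *: y).

Local Notation E g := (\int[lam]_x (F x * g x)%:E)%E.

(** Midpoint log-concavity in a form that needs no logarithm of 0. *)
Lemma log_concave_midpoint x y : F x * F y <= F (2^-1 *: (x + y)) ^+ 2.
Proof.
have [|/negP] := boolP ((0 < F x) && (0 < F y)); last first.
  move=> xy0; apply: (@le_trans _ _ 0); last exact: sqr_ge0.
  have [Fx|Fx] := ltP 0 (F x); last by rewrite mulr_le0_ge0.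
  have [Fy|Fy] := ltP 0 (F y); last by rewrite mulr_ge0_le0// ltW.
  by rewrite Fx Fy in xy0.
move=> /andP[Fx Fy].
have half01 : 0 <= (2^-1 : R) <= 1 by lra.
have := @lc x y 2^-1 (- ln (F x)) (- ln (F y)) half01.
rewrite !opprK !lnK ?posrE// lexx => /(_ isT (lexx _)).
rewrite (_ : 1 - 2^-1 = 2^-1 :> R); last by lra.
rewrite -[_ *: x + _]scalerDr.
have -> : - (2^-1 * - ln (F x) + 2^-1 * - ln (F y)) = 2^-1 * (ln (F x) + ln (F y)) by ring.
move=> h.
have <- : expR (2^-1 * (ln (F x) + ln (F y))) ^+ 2 = F x * F y.
  rewrite -expRM_natr -[RHS](@lnK _ (F x * F y)) ?posrE ?mulr_gt0//.
  by rewrite lnM ?posrE//; congr expR; field.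
by rewrite ler_pXn2r// nnegrE ?expR_ge0.
Qed.

Lemma measurable_weighted (g : 'rV[R]_n -> R) : measurable_fun setT g ->
  measurable_fun setT (fun x => (F x * g x)%:E).
Proof. by move=> mg; apply/measurable_EFinP; exact: measurable_funM. Qed.

Lemma weighted_ge0 (g : 'rV[R]_n -> R) : (forall x, 0 <= g x) -> (0 <= E g)%E.
Proof. by move=> g0; apply: integral_ge0 => x _; rewrite lee_fin mulr_ge0. Qed.

Lemma weighted_le (g h : 'rV[R]_n -> R) : measurable_fun setT g -> measurable_fun setT h ->
  (forall x, 0 <= g x <= h x) -> (E g <= E h)%E.
Proof.
move=> mg mh gh; apply: ge0_le_integral => //.
- by move=> x _; have /andP[g0 _] := gh x; rewrite lee_fin mulr_ge0.
- exact: measurable_weighted.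
- exact: measurable_weighted.
- by move=> x _; have /andP[_ ?] := gh x; rewrite lee_fin ler_wpM2l.
Qed.

Lemma weighted_add (g h : 'rV[R]_n -> R) : measurable_fun setT g -> measurable_fun setT h ->
  (forall x, 0 <= g x) -> (forall x, 0 <= h x) ->
  (E (fun x => g x + h x) = E g + E h)%E.
Proof.
move=> mg mh g0 h0; rewrite -ge0_integralD//; last 4 first.
- by move=> x _; rewrite lee_fin mulr_ge0.
- exact: measurable_weighted.
- by move=> x _; rewrite lee_fin mulr_ge0.
- exact: measurable_weighted.
by apply: eq_integral => x _; rewrite mulrDr EFinD.
Qed.

Lemma weighted_scale (c : R) (g : 'rV[R]_n -> R) : 0 <= c -> measurable_fun setT g ->
  (forall x, 0 <= g x) -> (E (fun x => c * g x)%R = c%:E * E g)%E.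
Proof.
move=> c0 mg g0; rewrite -ge0_integralZl//; last 2 first.
- exact: measurable_weighted.
- by move=> x _; rewrite lee_fin mulr_ge0.
by apply: eq_integral => x _; rewrite -EFinM mulrCA.
Qed.

Lemma weighted_cst (c : R) : 0 <= c -> (E (fun=> c) = c%:E)%E.
Proof.
move=> c0; have -> : E (fun=> c) = (\int[lam]_x (c%:E * (F x)%:E))%E.
  by apply: eq_integral => x _; rewrite -EFinM mulrC.
rewrite ge0_integralZl// ?F1 ?mule1//; first exact/measurable_EFinP.
by move=> x _; rewrite lee_fin.
Qed.

(** Prekopa-Leindler for F 1_{Y >= 0}, F (Y+)^2 and 2 F Y+: if Y x >= 0 then
    Y y <= Y x + Y y = 2 Y ((x + y) / 2). *)
Lemma reverse_hoelder (Y : 'rV[R]_n -> R) : measurable_fun setT Y ->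
  (forall x y, 2 * Y (2^-1 *: (x + y)) = Y x + Y y) ->
  (E (\1_[set x | (0 <= Y x)%R]) * E (fun x => Num.max (Y x) 0 ^+ 2) <=
   E (fun x => (2 * Num.max (Y x) 0)%R) * E (fun x => (2 * Num.max (Y x) 0)%R))%E.
Proof.
move=> mY Ymid.
have mYp : measurable_fun setT (fun x => Num.max (Y x) 0) by exact: measurable_maxr.
have mYpos : measurable [set x | 0 <= Y x] by exact: measurable_ler_set.
have Yp0 x : 0 <= Num.max (Y x) 0 by rewrite le_max lexx orbT.
apply: prekopa_leindler.
- by apply: measurable_weighted; exact: measurable_indic.
- by apply: measurable_weighted; exact: measurable_funX.
- by apply: measurable_weighted; exact: measurable_funM.
- by move=> x; rewrite lee_fin mulr_ge0// indicE.
- by move=> x; rewrite lee_fin mulr_ge0// sqr_ge0.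
- by move=> x; rewrite lee_fin mulr_ge0// mulr_ge0.
move=> x y; rewrite -!EFinM lee_fin.
set z := 2^-1 *: (x + y).
have FF := log_concave_midpoint x y.
have zz : 0 <= F z * (2 * Num.max (Y z) 0) by rewrite mulr_ge0// mulr_ge0.
rewrite indicE; have [Yx|Yx] := leP 0 (Y x); last first.
  rewrite memNset; first by rewrite mulr0 mul0r mulr_ge0.
  by rewrite /= leNgt Yx.
rewrite mem_set// mulr1.
have [Yy|Yy] := leP (Y y) 0; first by rewrite expr0n !mulr0 mulr_ge0.
have Yz := Ymid x y; rewrite -/z in Yz FF.
have Yz0 : 0 <= Y z by lra.
rewrite (max_idPl Yz0) mulrA.
apply: (@le_trans _ _ (F z ^+ 2 * (2 * Y z) ^+ 2)); last by rewrite -exprMn expr2.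
have Yy0 : 0 <= Y y by exact: ltW.
apply: ler_pM; rewrite ?mulr_ge0 ?sqr_ge0//.
by rewrite ler_pXn2r// ?nnegrE// Yz; lra.
Qed.

Section second_moment.
Variable X : 'rV[R]_n -> R.
Hypothesis mX : measurable_fun setT X.
Hypothesis Xmid : forall x y, 2 * X (2^-1 *: (x + y)) = X x + X y.

Let mpos (g : 'rV[R]_n -> R) : measurable_fun setT g ->
  measurable_fun setT (fun x => Num.max (g x) 0).
Proof. by move=> mg; exact: measurable_maxr. Qed.

Let max_ge0 (a : R) : 0 <= Num.max a 0.
Proof. by rewrite le_max lexx orbT. Qed.

(** Apply the reverse Hoelder inequality to Y = X + 4c, which is nonnegative
    with probability at least 3/4 by Markov's inequality for the negative part
    of X, and whose positive part has expectation at most 5c. *)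
Lemma second_moment_pos (c : R) : 0 < c ->
  (E (fun x => Num.max (X x) 0) <= c%:E)%E ->
  (E (fun x => Num.max (- X x) 0) <= c%:E)%E ->
  (E (fun x => Num.max (X x) 0 ^+ 2) <= (400 / 3 * c ^+ 2)%:E)%E.
Proof.
move=> c0 Pc Qc.
pose Y x := X x + 4 * c.
have c4 : 0 <= 4 * c by rewrite mulr_ge0// ltW.
have mY : measurable_fun setT Y by exact: measurable_funD.
have Ymid x y : 2 * Y (2^-1 *: (x + y)) = Y x + Y y.
  by rewrite /Y mulrDr Xmid; ring.
have RH := reverse_hoelder mY Ymid.
have mYpos : measurable [set x | 0 <= Y x] by exact: measurable_ler_set.
have mind : measurable_fun setT (\1_[set x | 0 <= Y x] : _ -> R) by exact: measurable_indic.
have ind01 x : 0 <= (\1_[set x | 0 <= Y x] : _ -> R) x by rewrite indicE.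
have prob : ((3 / 4)%:E <= E (\1_[set x | (0 <= Y x)%R]))%E.
  have : (4 * c)%:E = E (fun=> (4 * c)%R) by rewrite weighted_cst.
  move=> Ec.
  have : (E (fun=> (4 * c)%R) <= E (fun x => (4 * c) * \1_[set x | (0 <= Y x)%R] x +
     Num.max (- X x) 0)%R)%E.
    apply: weighted_le => //.
      by apply: measurable_funD; [exact: measurable_funM|apply: mpos; exact: measurable_funN].
    move=> x; rewrite c4/= indicE.
    have [Yx|Yx] := leP 0 (Y x).
      by rewrite mem_set// mulr1 lerDl.
    rewrite memNset; last by rewrite /= leNgt Yx.
    by rewrite mulr0 add0r le_max; apply/orP; left; rewrite /Y in Yx; lra.
  rewrite -Ec weighted_add//; last 3 first.
  - exact: measurable_funM.
  - by apply: mpos; exact: measurable_funN.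
  - by move=> x; rewrite mulr_ge0.
  rewrite weighted_scale// => h.
  have {}h : ((4 * c)%:E <= (4 * c)%:E * E (\1_[set x | (0 <= Y x)%R]) + c%:E)%E.
    by apply: le_trans h _; exact: leeD2l.
  move: h (weighted_ge0 ind01); set V := E (\1_[set x | (0 <= Y x)%R]).
  case: V => [e|_ _|//]; last by rewrite leey.
  rewrite -EFinM -EFinD !lee_fin => h _.
  by rewrite -(ler_pM2l c0); lra.
have first : (E (fun x => 2 * Num.max (Y x) 0)%R <= (10 * c)%:E)%E.
  rewrite weighted_scale//; last exact: mpos.
  have : (E (fun x => Num.max (Y x) 0) <= E (fun x => Num.max (X x) 0 + 4 * c)%R)%E.
    apply: weighted_le; [exact: mpos|by apply: measurable_funD => //; exact: mpos|].
    move=> x; rewrite max_ge0/= ge_max /Y lerD2r le_max lexx/=.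
    by rewrite addr_ge0.
  rewrite weighted_add//; last exact: mpos.
  rewrite weighted_cst// => h.
  have {}h : (E (fun x => Num.max (Y x) 0) <= c%:E + (4 * c)%:E)%E.
    by apply: le_trans h _; exact: leeD2r.
  apply: (@le_trans _ _ (2%:E * (c%:E + (4 * c)%:E))%E); first by rewrite lee_pmul2l.
  by rewrite -EFinD -EFinM lee_fin; lra.
have second : (E (fun x => Num.max (X x) 0 ^+ 2) <= E (fun x => Num.max (Y x) 0 ^+ 2))%E.
  apply: weighted_le; [by apply: measurable_funX; exact: mpos|by apply: measurable_funX; exact: mpos|].
  move=> x; rewrite sqr_ge0/= ler_pXn2r// ?nnegrE//.
  by rewrite ge_max max_ge0 andbT le_max /Y lerDl c4.
apply: le_trans second _.
have Ysq0 : (0 <= E (fun x => Num.max (Y x) 0 ^+ 2))%E by apply: weighted_ge0 => x; exact: sqr_ge0.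
have Yp0 : (0 <= E (fun x => 2 * Num.max (Y x) 0)%R)%E by apply: weighted_ge0 => x; exact: mulr_ge0.
have : ((3 / 4)%:E * E (fun x => Num.max (Y x) 0 ^+ 2) <= (10 * c)%:E * (10 * c)%:E)%E.
  apply: le_trans (le_trans RH _); last exact: lee_pmul.
  by apply: lee_wpmul2r.
move: Ysq0; set V := E (fun x => Num.max (Y x) 0 ^+ 2).
case: V => [e| |//]; last by rewrite mulry gtr0_sg// mul1e.
move=> _; rewrite -!EFinM !lee_fin; nra.
Qed.

End second_moment.

Section isotropic.
Hypothesis mean0 : forall i, (E (fun x : 'rV[R]_n => x 0 i) = 0)%E.
Hypothesis cov1 : forall i j, (E (fun x : 'rV[R]_n => x 0 i * x 0 j)%R = (i == j)%:R%:E)%E.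

Let E_dot : (E (fun x => dot x x) = n%:R%:E)%E.
Proof.
transitivity (\int[lam]_x \sum_(i < n) (F x * (x 0 i * x 0 i))%:E)%E.
  by apply: eq_integral => x _; rewrite sumEFin -mulr_sumr.
rewrite ge0_integral_sum//; last 2 first.
- by move=> i; apply: measurable_weighted; apply: measurable_funM; exact: measurable_coord.
- by move=> i x _; rewrite lee_fin mulr_ge0// -expr2 sqr_ge0.
under eq_bigr do rewrite cov1 eqxx.
by rewrite sumEFin -[in RHS](card_ord n) -sumr_const.
Qed.

Let E_dot1 : (E (fun x => 1 + dot x x)%R < +oo)%E.
Proof.
rewrite weighted_add//; last 2 first.
- by apply: measurable_sum => i; apply: measurable_funM; exact: measurable_coord.
- exact: dot_ge0.
by rewrite weighted_cst// E_dot -EFinD ltry.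
Qed.

Let integrable_quadratic (g : 'rV[R]_n -> R) : measurable_fun setT g ->
  (forall x, `|g x| <= 1 + dot x x) -> lam.-integrable setT (fun x => (F x * g x)%:E).
Proof.
move=> mg gd; apply/integrableP; split; first exact: measurable_weighted.
apply: le_lt_trans E_dot1.
rewrite (eq_integral (fun x => (F x * `|g x|)%:E)); last first.
  by move=> x _; rewrite /= normrM (ger0_norm (F0 x)).
apply: weighted_le.
- exact: measurableT_comp.
- apply: measurable_funD => //.
  by apply: measurable_sum => i; apply: measurable_funM; exact: measurable_coord.
- by move=> x; rewrite normr_ge0 gd.
Qed.

Let coord_le (x : 'rV[R]_n) i : `|x 0 i| <= 1 + dot x x.
Proof.
have := coord_sqr_le_dot x i; have := sqr_ge0 (x 0 i).
by rewrite -[_ ^+ 2]real_normK ?num_real//; move: `|_| => a; nra.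
Qed.

Let coord2_le (x : 'rV[R]_n) i j : `|x 0 i * x 0 j| <= 1 + dot x x.
Proof.
have := coord_sqr_le_dot x i; have := coord_sqr_le_dot x j.
rewrite -[x 0 i ^+ 2]real_normK ?num_real// -[x 0 j ^+ 2]real_normK ?num_real//.
have := dot_ge0 x.
rewrite normrM; move: (`|x 0 i|) (`|x 0 j|) (dot x x) => a b c.
by have := sqr_ge0 (a - b); nra.
Qed.

Variable u : 'rV[R]_n.
Hypothesis u1 : dot u u = 1.

Lemma dot_mean0 : (E (fun x => dot x u) = 0)%E.
Proof.
transitivity (\int[lam]_x \sum_(i < n) ((u 0 i)%:E * (F x * x 0 i)%:E))%E.
  apply: eq_integral => x _; rewrite sumEFin; congr (_%:E).
  by rewrite /dot mulr_sumr; apply: eq_bigr => i _; ring.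
have icoord i : lam.-integrable setT (fun x : 'rV[R]_n => (F x * x 0 i)%:E).
  by apply: integrable_quadratic; [exact: measurable_coord|move=> x; exact: coord_le].
rewrite integral_sum//; last by move=> i; exact: integrableZl.
by rewrite big1// => i _; rewrite integralZl// mean0 mule0.
Qed.

Lemma dot_var1 : (E (fun x => dot x u ^+ 2) = 1)%E.
Proof.
transitivity (\int[lam]_x \sum_(i < n) \sum_(j < n)
    ((u 0 i * u 0 j)%:E * (F x * (x 0 i * x 0 j))%:E))%E.
  apply: eq_integral => x _; under eq_bigr do rewrite sumEFin.
  rewrite sumEFin; congr (_%:E).
  rewrite expr2 /dot mulr_suml mulr_sumr; apply: eq_bigr => i _.
  by rewrite !mulr_sumr; apply: eq_bigr => j _; ring.
have ic i j : lam.-integrable setT (fun x : 'rV[R]_n => (F x * (x 0 i * x 0 j))%:E).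
  apply: integrable_quadratic; last by move=> x; exact: coord2_le.
  by apply: measurable_funM; exact: measurable_coord.
rewrite integral_sum//; last first.
  by move=> i; apply: integrable_sum => // j _; exact: integrableZl.
rewrite (eq_bigr (fun i => (u 0 i * u 0 i)%:E))%E.
  by rewrite sumEFin -/(dot u u) u1.
move=> i _; rewrite integral_sum//; last by move=> j; exact: integrableZl.
rewrite (bigD1 i)//= big1 => [|j ji]; last first.
  by rewrite integralZl// cov1 eq_sym (negbTE ji) mule0.
by rewrite adde0 integralZl// cov1 eqxx mule1.
Qed.

Let mX : measurable_fun setT (fun x : 'rV[R]_n => dot x u).
Proof. exact: measurable_dot. Qed.

Let X2_le x : dot x u ^+ 2 <= dot x x.
Proof. by apply: le_trans (cauchy_schwarz x u) _; rewrite u1 mulr1. Qed.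

(** As EX = 0, the positive and negative parts of X = <x, u> have the same
    expectation.  Were it at most c = 1/17, both second moments would be at
    most 400/3 c^2, and 800/3 c^2 < 1 = EX^2. *)
Lemma dot_pos_part_lower : ((17^-1)%:E < E (fun x => Num.max (dot x u) 0))%E.
Proof.
rewrite ltNge; apply/negP => P17.
have mXp : measurable_fun setT (fun x : 'rV[R]_n => Num.max (dot x u) 0).
  exact: measurable_maxr.
have mXn : measurable_fun setT (fun x : 'rV[R]_n => Num.max (- dot x u) 0).
  by apply: measurable_maxr => //; exact: measurable_funN.
have absle x : `|dot x u| <= 1 + dot x x.
  have := X2_le x; rewrite -[_ ^+ 2]real_normK ?num_real//.
  by move: `|_| => a; nra.
have ip : lam.-integrable setT (fun x : 'rV[R]_n => (F x * Num.max (dot x u) 0)%:E).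
  apply: integrable_quadratic => // x; apply: le_trans (absle x).
  rewrite ger0_norm ?le_max ?lexx ?orbT//.
  by rewrite ge_max normr_ge0 ler_norm.
have im : lam.-integrable setT (fun x : 'rV[R]_n => (F x * Num.max (- dot x u) 0)%:E).
  apply: integrable_quadratic => // x; apply: le_trans (absle x).
  rewrite ger0_norm ?le_max ?lexx ?orbT//.
  by rewrite ge_max normr_ge0 -normrN ler_norm.
have PQ : (E (fun x => Num.max (- dot x u) 0) = E (fun x => Num.max (dot x u) 0))%E.
  have : (E (fun x => Num.max (dot x u) 0) - E (fun x => Num.max (- dot x u) 0) = 0)%E.
    rewrite -integralB_EFin// -dot_mean0; apply: eq_integral => x _.
    rewrite -EFinB -mulrBr; congr (_ * _)%:E.
    by have [h|h] := leP 0 (dot x u); [rewrite max_r|rewrite max_l]; lra.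
  have fp := integrable_fin_num measurableT ip.
  have fm := integrable_fin_num measurableT im.
  by rewrite -(fineK fp) -(fineK fm) -EFinB => -[/eqP]; rewrite subr_eq0 => /eqP ->.
have Xmid (x y : 'rV[R]_n) : 2 * dot (2^-1 *: (x + y)) u = dot x u + dot y u.
  by rewrite !dotE; field.
have Xmidn (x y : 'rV[R]_n) : 2 * - dot (2^-1 *: (x + y)) u = - dot x u + - dot y u.
  by rewrite mulrN Xmid opprD.
have c0 : 0 < 17^-1 :> R by lra.
have Qb : (E (fun x => Num.max (- dot x u) 0) <= 17^-1%:E)%E by rewrite PQ.
have S1 := second_moment_pos mX Xmid c0 P17 Qb.
have Pb' : (E (fun x => Num.max (- - dot x u) 0) <= 17^-1%:E)%E.
  by under eq_integral do rewrite opprK.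
have S2 := second_moment_pos (measurable_funN mX) Xmidn c0 Qb Pb'.
have : (E (fun x => dot x u ^+ 2) = E (fun x => Num.max (dot x u) 0 ^+ 2) +
    E (fun x => Num.max (- dot x u) 0 ^+ 2))%E.
  rewrite -weighted_add; last 4 first.
  - exact: measurable_funX.
  - exact: measurable_funX.
  - by move=> x; exact: sqr_ge0.
  - by move=> x; exact: sqr_ge0.
  apply: eq_integral => x _; congr (_ * _)%:E.
  have [h|h] := leP 0 (dot x u).
    by rewrite max_r ?expr0n ?addr0//; lra.
  by rewrite max_l ?expr0n ?add0r ?sqrrN//; lra.
rewrite dot_var1 => /esym one.
have := leeD S1 S2; rewrite one -EFinD lee_fin.
by rewrite expr2; lra.
Qed.

End isotropic.
End reverse_hoelder.

(** * Level sets of an isotropic log-concave density *)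

Section level_sets.
Context (R : realType) (n : nat).
Local Notation lam := (lebesgue_rV R n).
Variable F : 'rV[R]_n -> R.
Hypothesis n0 : (0 < n)%N.
Hypothesis mF : measurable_fun setT F.
Hypothesis F0 : forall x, 0 <= F x.
Hypothesis F1 : (\int[lam]_x (F x)%:E = 1)%E.
Hypothesis lc : forall x y (t p q : R), 0 <= t <= 1 ->
  expR (- p) <= F x -> expR (- q) <= F y ->
  expR (- (t * p + (1 - t) * q)) <= F (t *: x + (1 - t) *: y).
Local Notation E g := (\int[lam]_x (F x * g x)%:E)%E.
Hypothesis mean0 : forall i, (E (fun x : 'rV[R]_n => x 0 i) = 0)%E.
Hypothesis cov1 : forall i j, (E (fun x : 'rV[R]_n => x 0 i * x 0 j)%R = (i == j)%:R%:E)%E.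

Lemma superlevel_convex (c : R) : 0 < c -> segment_convex [set x | c <= F x].
Proof.
move=> c0 x y t t01 /= cx cy.
have := @lc x y t (- ln c) (- ln c) t01.
rewrite opprK lnK ?posrE// => /(_ cx cy).
by rewrite (_ : - (_ + _) = ln c) ?lnK ?posrE//; ring.
Qed.

(** If F x < q^2 F x1, the midpoint inequality gives F x <= q F ((x + x1) / 2),
    and the right-hand side has integral q 2^n. *)
Lemma sublevel_mass (q : R) (x1 : 'rV[R]_n) : 0 <= q ->
  (\int[lam]_(x in [set x | (F x < q ^+ 2 * F x1)%R]) (F x)%:E <= (q * 2 ^+ n)%:E)%E.
Proof.
move=> q0; pose m x := 2^-1 *: x + 2^-1 *: x1.
have mm : measurable_fun setT (fun x => (F (m x))%:E).
  apply/measurable_EFinP; apply: (measurableT_comp mF).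
  exact: measurable_affine.
have mS : measurable [set x | F x < q ^+ 2 * F x1] by exact: measurable_ltr_set.
have -> : (q * 2 ^+ n)%:E = (\int[lam]_x (q%:E * (F (m x))%:E))%E.
  rewrite ge0_integralZl//; last by move=> x _; rewrite lee_fin.
  have h2 : 0 < 2^-1 :> R by rewrite invr_gt0.
  have mFE : measurable_fun setT (fun x => (F x)%:E) by exact/measurable_EFinP.
  have := ge0_integral_affine (2^-1 *: x1) h2 mFE (fun x => F0 x).
  by rewrite F1 mule1 exprVn invrK => ->; rewrite EFinM.
rewrite integral_mkcond; apply: ge0_le_integral => //.
- by move=> x _; apply: erestrict_ge0 => y _; rewrite lee_fin.
- apply/(measurable_restrictT _ _).1 => //; apply: measurable_funS measurableT _ _ => //.
  exact/measurable_EFinP.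
- exact: measurable_funeM.
move=> x _; rewrite patchE; case: ifPn => [|_]; last by rewrite -EFinM lee_fin mulr_ge0.
rewrite inE /= => Fx; rewrite -EFinM lee_fin.
have mid := log_concave_midpoint F0 lc x x1.
rewrite scalerDr -/(m x) in mid.
rewrite -(@ler_pXn2r _ 2)// ?nnegrE ?mulr_ge0//.
rewrite exprMn; apply: (@le_trans _ _ (q ^+ 2 * (F x * F x1))); last first.
  by rewrite ler_wpM2l// sqr_ge0.
by rewrite expr2 mulrCA ler_wpM2l// ltW.
Qed.

(** Any base works that makes 2 * base, a bound for the mass of the complement
    of the superlevel set, small enough for the constants below. *)
Definition level_base : R := (64 ^+ 2)^-1.

Let base0 : 0 < level_base.
Proof. by rewrite invr_gt0 exprn_gt0// ltr0n. Qed.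

Let base1 : level_base <= 1.
Proof. by rewrite invf_le1 ?exprn_gt0 ?ltr0n// exprn_ege1// ler1n. Qed.

Let q : R := level_base ^+ n.

Let q0 : 0 < q. Proof. exact: exprn_gt0. Qed.

Let mass_small (x1 : 'rV[R]_n) :
  (\int[lam]_(x in [set x | (F x < q ^+ 2 * F x1)%R]) (F x)%:E <= (34^-1 ^+ 2)%:E)%E.
Proof.
apply: le_trans (sublevel_mass _ (ltW q0)) _; rewrite lee_fin /q -exprMn.
have h : 0 <= level_base * 2 <= 1.
  by rewrite mulr_ge0 ?(ltW base0)//= /level_base mulrC ler_pdivrMr; lra.
apply: (@le_trans _ _ (level_base * 2)).
  by case: n n0 => // k _; rewrite exprS ler_piMr ?exprn_ile1//; have /andP[] := h.
by rewrite /level_base; lra.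
Qed.

(** Otherwise X = <x, u> is at most 1/68 outside a set G of mass at most
    1/34^2, and its positive part is dominated by g below, so its expectation
    would be at most 3/68 < 1/17. *)
Let halfspace_escape (x1 u : 'rV[R]_n) : dot u u = 1 ->
  (forall x, q ^+ 2 * F x1 <= F x -> dot x u <= 68^-1) -> False.
Proof.
move=> u1 Lu.
have mX := measurable_dot u.
have := dot_pos_part_lower mF F0 F1 lc mean0 cov1 u1.
apply/negP; rewrite -leNgt.
pose G : set 'rV[R]_n := [set x | F x < q ^+ 2 * F x1].
have mG : measurable G by exact: measurable_ltr_set.
have mind : measurable_fun setT (\1_G : _ -> R) by exact: measurable_indic.
(* on G use 2 X <= X^2 / 34 + 34 *)
pose g x : R := (68^-1 + 68^-1 * dot x u ^+ 2) + 17 * \1_G x.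
have gx x : 0 <= Num.max (dot x u) 0 <= g x.
  rewrite le_max lexx orbT/= /g indicE.
  have sq := sqr_ge0 (dot x u).
  have [xG|xG] := pselect (G x).
    rewrite mem_set// mulr1 ge_max; apply/andP; split; last lra.
    by have := sqr_ge0 (dot x u - 34); nra.
  rewrite memNset// mulr0 addr0 ge_max; apply/andP; split; last lra.
  have : dot x u <= 68^-1 by apply: Lu; rewrite leNgt; exact/negP.
  by lra.
have mg : measurable_fun setT g.
  apply: measurable_funD; last exact: measurable_funM.
  by apply: measurable_funD => //; apply: measurable_funM => //; exact: measurable_funX.
have mX2 : measurable_fun setT (fun x : 'rV[R]_n => dot x u ^+ 2) by exact: measurable_funX.
apply: (@le_trans _ _ (E g)).
  apply: weighted_le => //; exact: measurable_maxr.
have ind0 x : 0 <= (\1_G : _ -> R) x by rewrite indicE.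
have c68 : 0 <= 68^-1 :> R by lra.
have X20 (x : 'rV[R]_n) : 0 <= 68^-1 * dot x u ^+ 2 by rewrite mulr_ge0// sqr_ge0.
have mX2' : measurable_fun setT (fun x : 'rV[R]_n => 68^-1 * dot x u ^+ 2).
  exact: measurable_funM.
have m1 : measurable_fun setT (fun x : 'rV[R]_n => 68^-1 + 68^-1 * dot x u ^+ 2).
  exact: measurable_funD.
have m2 : measurable_fun setT (fun x => 17 * (\1_G : _ -> R) x).
  exact: measurable_funM.
have p1 (x : 'rV[R]_n) : 0 <= 68^-1 + 68^-1 * dot x u ^+ 2 by rewrite addr_ge0.
have p2 x : 0 <= 17 * (\1_G : _ -> R) x by rewrite mulr_ge0.
rewrite /g (weighted_add mF F0 m1 m2 p1 p2).
rewrite (weighted_add mF F0 (measurable_cst _) mX2' (fun=> c68) X20).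
rewrite (weighted_cst mF F0 F1 c68).
rewrite (weighted_scale mF F0 c68 mX2 (fun x => sqr_ge0 _)).
rewrite (weighted_scale mF F0 _ mind ind0)//.
rewrite dot_var1// mule1.
have -> : E \1_G = (\int[lam]_(x in G) (F x)%:E)%E.
  rewrite (integral_mkcond G); apply: eq_integral => x _.
  by rewrite patchE indicE; case: (x \in G); rewrite ?mulr1 ?mulr0.
apply: (@le_trans _ _ (68^-1%:E + 68^-1%:E + 17%:E * (34^-1 ^+ 2)%:E)%E).
  by rewrite leeD2l// lee_pmul2l//; exact: mass_small.
by rewrite -EFinM -!EFinD lee_fin; lra.
Qed.

(** A point v of the ball outside the closure of the superlevel set would be
    separated from it by a half-space at distance at most 1/68 from the origin.
    Hence the closure contains an open ball, and a convex set contains the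
    interior of its closure. *)
Lemma near0_superlevel (v x1 : 'rV[R]_n) : dot v v < 68^-1 ^+ 2 ->
  q ^+ 2 * F x1 <= F v.
Proof.
move=> v68.
have [Fx1|Fx1] := leP (F x1) 0.
  by apply: le_trans (F0 v); rewrite mulr_ge0_le0// sqr_ge0.
pose L : set 'rV[R]_n := [set x | q ^+ 2 * F x1 <= F x].
have q20 : 0 < q ^+ 2 by rewrite exprn_gt0.
have c0 : 0 < q ^+ 2 * F x1 by rewrite mulr_gt0.
have cL : segment_convex L by exact: superlevel_convex.
have Lx1 : L x1.
  by rewrite /L/= ler_piMl ?(ltW Fx1)// exprn_ile1 ?(ltW q0)// /q exprn_ile1// ltW.
have sub (w : 'rV[R]_n) : dot w w < 68^-1 ^+ 2 -> closure L w.
  move=> w68; apply: contrapT => nLw.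
  have L0 : closure L !=set0 by exists x1; exact: subset_closure.
  have [p [u [Lp u1 wE Lu]]] :=
    separation_closed_convex (@closed_closure _ L) (closure_segment_convex cL) L0 nLw.
  apply: (halfspace_escape u1 (x1 := x1)) => x Lx.
  apply: le_trans (Lu x (@subset_closure _ L x Lx)) _.
  apply: (@le_trans _ _ (dot w u)).
    by rewrite wE dotDl dotZl u1 mulr1 lerDl euclid_norm_ge0.
  by apply: dot_unit_le => //; exact: ltW.
have : open [set w : 'rV[R]_n | dot w w < 68^-1 ^+ 2].
  rewrite (_ : mkset _ = (fun x : 'rV[R]_n => dot (x - 0) (x - 0)) @^-1` [set r | r < 68^-1 ^+ 2]).
    by apply: open_comp => [x _|]; [exact: sqr_dist_continuous|exact: open_lt].
  by apply/seteqP; split=> x; rewrite /= subr0.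
move=> /(_ v v68)/nbhs_ballP[rho /= rho0 vrho].
by apply: (@interior_closure_convex R n L v rho cL rho0) => w /vrho; exact: sub.
Qed.

(** Rate K in the estimate F v >= exp (- n K) F x for v near the origin. *)
Definition decay : R := - ln (level_base ^+ 2).

Lemma decay_ge0 : 0 <= decay.
Proof. by rewrite oppr_ge0 ln_le0// exprn_ile1// ltW. Qed.

(** Apply log-concavity along the segment from x to v, knowing that
    log F v >= log F x - n K. *)
Lemma log_concave_star (v x : 'rV[R]_n) (s : R) : dot v v <= 136^-1 ^+ 2 ->
  0 <= s <= 1 ->
  expR (- (s * (n%:R * decay))) * F x <= F ((1 - s) *: x + s *: v).
Proof.
move=> v136 s01.
have [Fx|Fx] := leP (F x) 0.
  by apply: le_trans (F0 _); rewrite mulr_ge0_le0// expR_ge0.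
have v68 : dot v v < 68^-1 ^+ 2.
  by apply: le_lt_trans v136 _; rewrite ltr_pXn2r// ?nnegrE; lra.
have Fv := near0_superlevel x v68.
have s01' : 0 <= 1 - s <= 1 by move: s01 => /andP[]; lra.
have := @lc x v (1 - s) (- ln (F x)) (- ln (F x) + n%:R * decay) s01'.
rewrite opprK lnK ?posrE// lexx => /(_ isT).
have -> : expR (- (- ln (F x) + n%:R * decay)) = q ^+ 2 * F x.
  rewrite opprD opprK expRD lnK ?posrE// mulrC; congr (_ * _).
  rewrite /decay mulrN opprK mulrC expRM_natr lnK ?posrE; last exact: exprn_gt0.
  by rewrite /q -!exprM mulnC.
move=> /(_ Fv).
rewrite subKr => h; apply: le_trans h.
rewrite -{1}(@lnK _ (F x)) ?posrE// -expRD ler_expR; lra.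
Qed.

End level_sets.

(** * The upper bound *)

Section upper_bound.
Context (R : realType) (n : nat).
Local Notation lam := (lebesgue_rV R n).

Lemma log_concave_fin (f : 'rV[R]_n -> \bar R) : log_concave f ->
  forall x, f x = (fine (f x))%:E /\ 0 <= fine (f x).
Proof.
move=> [psi [psiN _ fE]] x; rewrite fE; have := psiN x.
by case: (psi x) => [r| |] //= _; split => //; exact: expR_ge0.
Qed.

(** exp (- p) <= F x says psi x <= p; bounding psi by reals avoids all infinite
    values. *)
Lemma log_concave_real (f : 'rV[R]_n -> \bar R) : log_concave f ->
  forall x y (t p q : R), 0 <= t <= 1 ->
  expR (- p) <= fine (f x) -> expR (- q) <= fine (f y) ->
  expR (- (t * p + (1 - t) * q)) <= fine (f (t *: x + (1 - t) *: y)).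
Proof.
move=> [psi [psiN psiC fE]] x y t p q t01.
have level z (r : R) : (expR (- r) <= fine (f z)) = (psi z <= r%:E)%E.
  rewrite fE; have := psiN z; case: (psi z) => [a| |] //= _.
    by rewrite ler_expR lerN2 lee_fin.
  by rewrite leNgt expR_gt0.
rewrite !level => px qy; apply: le_trans (psiC x y t t01) _.
move: t01 => /andP[t0 t1].
rewrite [leRHS]EFinD (EFinM t) (EFinM (1 - t)).
by apply: leeD; apply: lee_wpmul2l; rewrite ?lee_fin ?subr_ge0.
Qed.

Lemma Gamma_le : (0 < n)%N ->
  (Gamma R n <= (136 * (decay R + 1) * n%:R)%:E)%E.
Proof.
move=> n0; apply: ge_ereal_sup => _ [mu [f [[mf muf] lcf [mean0 cov1]]] <-].
apply: ge_ereal_sup => _ [A cA <-].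
pose F x := fine (f x).
have fE : f = fun x => (F x)%:E.
  by apply/funext => x; have [] := log_concave_fin lcf x.
have F0 x : 0 <= F x by have [] := log_concave_fin lcf x.
have mF : measurable_fun setT F.
  by apply/measurable_EFinP; rewrite -[EFin \o F]/(fun x => (F x)%:E) -fE.
have F1 : (\int[lam]_x (F x)%:E = 1)%E.
  by rewrite -(probability_setT mu) muf// fE.
have lcF := log_concave_real lcf.
have mean0' i : (\int[lam]_x (F x * x 0%R i)%:E = 0)%E.
  by rewrite -(mean0 i); apply: eq_integral => x _; rewrite fE -EFinM mulrC.
have cov1' i j : (\int[lam]_x (F x * (x 0%R i * x 0%R j))%:E = (i == j)%:R%:E)%E.
  have := cov1 i j; rewrite mxE => <-.
  by apply: eq_integral => x _; rewrite fE -EFinM mulrC.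
have D0 : 0 <= n%:R * decay R by rewrite mulr_ge0// decay_ge0.
have r0 : 0 < 136^-1 :> R by rewrite invr_gt0.
have star := log_concave_star n0 mF F0 F1 lcF mean0' cov1'.
apply: le_trans (perimeter_le mF F0 F1 D0 r0 star _ cA) _.
  by move=> B mB; rewrite muf// fE.
by rewrite invrK lee_fin le_eqVlt; apply/orP; left; apply/eqP; ring.
Qed.

End upper_bound.

(** * Integrals of product functions *)

Section product_integral.
Context (R : realType).
Local Notation leb := (@lebesgue_measure R).

Lemma integral_shifted_power (w : R) (k : nat) : 0 < w ->
  (\int[leb]_(t in `[(- w)%R, w]) ((t + w) ^+ k)%:E = ((2 * w) ^+ k.+1 / k.+1%:R)%:E)%E.
Proof.
move=> w0.
pose p : {poly R} := (k.+1%:R^-1)%:P * ('X + w%:P) ^+ k.+1.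
have pE t : p.[t] = k.+1%:R^-1 * (t + w) ^+ k.+1 by rewrite !hornerE.
have k1 : k.+1%:R != 0 :> R by rewrite pnatr_eq0.
have dpE t : p^`().[t] = (t + w) ^+ k.
  rewrite /p derivM derivC mul0r add0r deriv_exp derivD derivX derivC addr0 mul1r/=.
  by rewrite !hornerE/= hornerMn !hornerE mulrnAr -mulrnAl -[_^-1 *+ _]mulr_natr mulVf ?mul1r.
have -> : (\int[leb]_(t in `[(- w)%R, w]) ((t + w) ^+ k)%:E =
    \int[leb]_(t in `[(- w)%R, w]) (p^`().[t])%:E)%E.
  by apply: eq_integral => t _; rewrite dpE.
rewrite (@continuous_FTC2 _ _ (horner p)).
- rewrite !pE -EFinB addNr expr0n/= mulr0 subr0 mulrC.
  by rewrite (_ : w + w = 2 * w)//; ring.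
- lra.
- by apply: continuous_subspaceT; exact: continuous_horner.
- split.
  + by move=> x _; exact: derivable_horner.
  + by apply: cvg_at_right_filter; exact: continuous_horner.
  + by apply: cvg_at_left_filter; exact: continuous_horner.
- by move=> x _; rewrite derivE.
Qed.

Lemma rV_cons0 n (t : R) (y : 'rV[R]_n) : rV_cons (t, y) 0 ord0 = t.
Proof.
rewrite /rV_cons mxE; case: splitP => // j _.
by rewrite mxE (ord1 j) eqxx mulr1n.
Qed.

Lemma rV_cons_lift n (t : R) (y : 'rV[R]_n) i : rV_cons (t, y) 0 (lift ord0 i) = y 0 i.
Proof.
rewrite /rV_cons mxE; case: splitP => [j|j [ij]]; first by rewrite (ord1 j).
by congr (y _ _); exact/val_inj.
Qed.

Lemma measurable_prod_coord n (g : 'I_n -> R -> R) :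
  (forall i, measurable_fun setT (g i)) ->
  measurable_fun setT (fun x : 'rV[R]_n => \prod_(i < n) g i (x 0 i)).
Proof.
move=> mg; apply: measurable_prod => i _.
by apply: (measurableT_comp (mg i)); exact: measurable_coord.
Qed.

(** Restricted to nonnegative factors, for which Tonelli's theorem needs no
    integrability. *)
Lemma ge0_integral_prod n (g : 'I_n -> R -> R) :
  (forall i, measurable_fun setT (g i)) -> (forall i t, 0 <= g i t) ->
  (\int[lebesgue_rV R n]_x (\prod_(i < n) g i (x 0%R i))%:E =
   \prod_(i < n) \int[leb]_t (g i t)%:E)%E.
Proof.
elim: n g => [|n IH] g mg g0.
  rewrite big_ord0 (_ : (fun x => _) = cst 1%E); last first.
    by apply/funext => x; rewrite big_ord0.
  by rewrite integral_dirac// diracT mul1e.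
have mp := measurable_prod_coord mg.
rewrite ge0_integral_rVS; last 2 first.
- exact/measurable_EFinP.
- by move=> x; rewrite lee_fin prodr_ge0.
rewrite big_ord_recl.
transitivity (\int[leb]_t ((g ord0 t)%:E *
    \prod_(i < n) \int[leb]_t (g (lift ord0 i) t)%:E))%E.
  apply: eq_integral => t _.
  rewrite -(IH (fun i => g (lift ord0 i)))//.
  rewrite -ge0_integralZl//; last 3 first.
  - by apply/measurable_EFinP; exact: (@measurable_prod_coord n (fun i => g (lift ord0 i)) (fun i => mg _)).
  - by move=> y _; rewrite lee_fin prodr_ge0.
  - by rewrite lee_fin.
  apply: eq_integral => y _; rewrite big_ord_recl rV_cons0 EFinM.
  by under eq_bigr do rewrite rV_cons_lift.
have mg0 : measurable_fun setT (fun t => (g ord0 t)%:E) by exact/measurable_EFinP.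
rewrite ge0_integralZr//; first by move=> t _; rewrite lee_fin; exact: g0.
by apply: prode_ge0 => i _; apply: integral_ge0 => t _; rewrite lee_fin; exact: g0.
Qed.

End product_integral.

(** * The cube *)

Section cube.
Context (R : realType) (n : nat).
Local Notation leb := (@lebesgue_measure R).
Local Notation lam := (lebesgue_rV R n).

Definition box (a : R) : set 'rV[R]_n := [set x | forall i, `[(- a)%R, a]%classic (x 0 i)].

Lemma boxE a x : box a x <-> forall i, - a <= x 0 i <= a.
Proof. by split=> H i; have := H i; rewrite /= in_itv. Qed.

Lemma box_coord a x i : box a x -> - a <= x 0 i <= a.
Proof. by move/boxE. Qed.

(* half-width of the cube whose coordinates have variance 1 *)
Let w : R := Num.sqrt 3.

Let ww : w ^+ 2 = 3. Proof. by rewrite sqr_sqrtr. Qed.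

Let w0 : 0 < w. Proof. by rewrite sqrtr_gt0. Qed.

Let phi (t : R) : R := (2 * w)^-1 * \1_(`[(- w)%R, w]) t.

Let mphi : measurable_fun setT phi.
Proof. by apply: measurable_funM => //; exact: measurable_indic. Qed.

Let phi0 (k : nat) t : 0 <= phi t * (t + w) ^+ k.
Proof.
rewrite /phi indicE -mulrA; apply: mulr_ge0; first by rewrite invr_ge0 mulr_ge0// ltW.
case: (boolP (t \in `[(- w)%R, w]%classic)) => [|_]; last by rewrite mul0r.
by rewrite inE/= mul1r in_itv/= => /andP[tw _]; rewrite exprn_ge0//; lra.
Qed.

Let mphik k : measurable_fun setT (fun t => phi t * (t + w) ^+ k).
Proof.
by apply: measurable_funM => //; apply: measurable_funX; exact: measurable_funD.
Qed.

Let integral_phi k :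
  (\int[leb]_t (phi t * (t + w) ^+ k)%:E = ((2 * w) ^+ k / k.+1%:R)%:E)%E.
Proof.
transitivity (\int[leb]_t ((2 * w)^-1%:E *
    ((fun t => ((t + w) ^+ k)%:E) \_ `[(- w)%R, w]) t))%E.
  apply: eq_integral => t _; rewrite patchE /phi indicE.
  case: (t \in `[(- w)%R, w]%classic); first by rewrite mulr1 EFinM.
  by rewrite mulr0 mul0r mule0.
rewrite ge0_integralZl//.
- rewrite -integral_mkcond integral_shifted_power// -EFinM; congr (_%:E).
  by rewrite exprS -(mulrA (2 * w)) mulKf// gt_eqF// mulr_gt0.
- apply/(measurable_restrictT _ _).1 => //; apply: measurable_funS measurableT _ _ => //.
  by apply/measurable_EFinP; apply: measurable_funX; exact: measurable_funD.
- move=> t _; apply: erestrict_ge0 => s /=; rewrite in_itv/= lee_fin => /andP[sw _].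
  by rewrite exprn_ge0//; lra.
- by rewrite lee_fin invr_ge0 mulr_ge0// ltW.
Qed.

Definition cube_density (x : 'rV[R]_n) : R := \prod_(i < n) phi (x 0 i).

Let F := cube_density.

Let c : R := (2 * w)^-1 ^+ n.

Let c0 : 0 < c. Proof. by rewrite exprn_gt0// invr_gt0 mulr_gt0. Qed.

Lemma cube_densityE x : F x = c * \1_(box w) x.
Proof.
rewrite /F /cube_density big_split/= big_const_ord iter_mulr_1; congr (_ * _).
rewrite indicE; have [bx|bx] := pselect (box w x).
  rewrite mem_set// big1// => i _; rewrite indicE mem_set//; exact: bx.
rewrite memNset//; move/existsNP : bx => [i xi].
by rewrite (bigD1 i)//= indicE memNset ?mul0r.
Qed.

Let mF : measurable_fun setT F.
Proof. exact: (@measurable_prod_coord R n (fun=> phi) (fun=> mphi)). Qed.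

(** The powers are those of x_i + w, nonnegative on the cube, so that the product
    formula for nonnegative functions applies; centred moments follow by
    linearity. *)
Let weighted_power (m : 'I_n -> nat) :
  (\int[lam]_x (F x * \prod_(i < n) (x 0%R i + w) ^+ m i)%:E =
   \prod_(i < n) ((2 * w) ^+ m i / (m i).+1%:R)%:E)%E.
Proof.
transitivity (\int[lam]_x (\prod_(i < n) (phi (x 0%R i) * (x 0%R i + w) ^+ m i))%:E)%E.
  by apply: eq_integral => x _; rewrite big_split.
rewrite (@ge0_integral_prod R n (fun i t => phi t * (t + w) ^+ m i))//.
by apply: eq_bigr => i _; exact: integral_phi.
Qed.

Let integrable_power (m : 'I_n -> nat) :
  lam.-integrable setT (fun x => (F x * \prod_(i < n) (x 0 i + w) ^+ m i)%:E).
Proof.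
apply/integrableP; split.
  apply/measurable_EFinP; apply: measurable_funM => //.
  have mp k : measurable_fun setT (fun t : R => (t + w) ^+ k).
    by apply: measurable_funX; exact: measurable_funD.
  exact: (@measurable_prod_coord R n (fun i t => (t + w) ^+ m i) (fun i => mp _)).
rewrite (eq_integral (fun x => (F x * \prod_(i < n) (x 0%R i + w) ^+ m i)%:E)).
  rewrite weighted_power; have [r ->] : exists r : R,
      (\prod_(i < n) ((2 * w) ^+ m i / (m i).+1%:R)%:E = r%:E)%E.
    by exists (\prod_(i < n) ((2 * w) ^+ m i / (m i).+1%:R)); rewrite prodEFin.
  by rewrite ltry.
move=> x _ /=; rewrite ger0_norm// -big_split/=; apply: prodr_ge0 => i _; exact: phi0.
Qed.

Let cube_mass : (\int[lam]_x (F x)%:E = 1)%E.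
Proof.
have := weighted_power (fun=> 0%N); rewrite big1 => [<-|i _]; last by rewrite expr0 divr1.
by apply: eq_integral => x _; rewrite big1 ?mulr1.
Qed.

Let integrable_F : lam.-integrable setT (fun x => (F x)%:E).
Proof.
have := integrable_power (fun=> 0%N); apply: eq_integrable => // x _.
by rewrite big1 ?mulr1.
Qed.

Let prod_delta (f : 'I_n -> R) i : \prod_(k < n) f k ^+ (k == i) = f i.
Proof.
rewrite (bigD1 i)//= eqxx expr1 big1 ?mulr1// => k /negbTE ->.
by rewrite expr0.
Qed.

Let mean_shift i : (\int[lam]_x (F x * (x 0%R i + w))%:E = w%:E)%E.
Proof.
have := weighted_power (fun k => (k == i) : nat).
rewrite (bigD1 i)//= eqxx big1 => [|k /negbTE ->]; last by rewrite expr0 divr1.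
rewrite mule1 expr1 => H; transitivity (2 * w / 2%:R)%:E; last by congr (_%:E); field.
by rewrite -H; apply: eq_integral => x _; rewrite prod_delta.
Qed.

Let integrable_shift i : lam.-integrable setT (fun x => (F x * (x 0 i + w))%:E).
Proof.
have := integrable_power (fun k => (k == i) : nat); apply: eq_integrable => // x _.
by rewrite prod_delta.
Qed.

Let prod_delta2 (f : 'I_n -> R) i j :
  \prod_(k < n) f k ^+ ((k == i) + (k == j))%N = f i * f j.
Proof. by under eq_bigr do rewrite exprD; rewrite big_split/= !prod_delta. Qed.

Let cov_shift i j :
  (\int[lam]_x (F x * ((x 0%R i + w) * (x 0%R j + w)))%:E = (3 + (i == j)%:R)%:E)%E.
Proof.
have := weighted_power (fun k => (k == i) + (k == j))%N.
have -> : (\int[lam]_x (F x * \prod_(k < n) (x 0%R k + w) ^+ ((k == i) + (k == j)))%:E =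
    \int[lam]_x (F x * ((x 0%R i + w) * (x 0%R j + w)))%:E)%E.
  by apply: eq_integral => x _; rewrite prod_delta2.
move=> ->; rewrite (bigD1 i)//= eqxx.
have [<-|ij] := eqVneq i j.
  rewrite big1 => [|k /negbTE ->]; last by rewrite expr0 divr1.
  rewrite mule1; congr (_%:E).
  rewrite -[(true + true)%N]/2%N exprMn ww -[true%:R]/(1 : R); lra.
rewrite (bigD1 j)//=; last by rewrite eq_sym.
rewrite eqxx eq_sym (negbTE ij) big1 => [|k /andP[/negbTE -> /negbTE ->]]; last by rewrite expr0 divr1.
rewrite mule1 -EFinM -[(true + false)%N]/1%N -[(false + true)%N]/1%N !expr1 -ww.
rewrite -[false%:R]/(0 : R); congr (_%:E).
by field.
Qed.

Let integrable_cov i j :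
  lam.-integrable setT (fun x => (F x * ((x 0 i + w) * (x 0 j + w)))%:E).
Proof.
have := integrable_power (fun k => (k == i) + (k == j))%N; apply: eq_integrable => // x _.
by rewrite prod_delta2.
Qed.

Lemma cube_isotropic : isotropic (fun x => (F x)%:E).
Proof.
have iwF := integrableZl measurableT w integrable_F.
have iwS i := integrableZl measurableT w (integrable_shift i).
split=> [i|i j].
  transitivity (\int[lam]_x ((F x * (x 0%R i + w))%:E - w%:E * (F x)%:E))%E.
    by apply: eq_integral => x _; rewrite -!EFinM -EFinB; congr (_%:E); ring.
  rewrite integralB// integralZl// cube_mass mule1.
  by rewrite mean_shift -EFinB subrr.
transitivity (\int[lam]_x (((F x * ((x 0%R i + w) * (x 0%R j + w)))%:E -
    w%:E * (F x * (x 0%R i + w))%:E) - (w%:E * (F x * (x 0%R j + w))%:E - 3%:E * (F x)%:E)))%E.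
  apply: eq_integral => x _; rewrite -!EFinM -!EFinB; congr (_%:E).
  by rewrite -ww; ring.
have i3F := integrableZl measurableT 3 integrable_F.
rewrite integralB//; last 2 first.
- exact: integrableB.
- exact: integrableB.
rewrite !integralB// !integralZl// cube_mass !mean_shift cov_shift mule1.
rewrite -!EFinM -!EFinB mxE; congr (_%:E); rewrite -expr2 ww; ring.
Qed.

Lemma cube_log_concave : log_concave (fun x => (F x)%:E).
Proof.
exists (fun x => if x \in box w then (- ln c)%:E else +oo%E); split.
- by move=> x; case: ifP.
- move=> x y t t01; have /andP[t0 t1] := t01.
  have [->|tn0] := eqVneq t 0.
    by rewrite scale0r add0r subr0 scale1r mul0e add0e mul1e.
  have [->|tn1] := eqVneq t 1.
    by rewrite scale1r subrr scale0r addr0 mul0e adde0 mul1e.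
  have tp : 0 < t by rewrite lt_neqAle eq_sym tn0.
  have t1p : 0 < 1 - t by rewrite subr_gt0 lt_neqAle tn1.
  case: (boolP (x \in box w)) => [xb|_]; last first.
    rewrite gt0_muley ?lte_fin// addye ?leey//.
    by case: ifP => _; rewrite ?gt0_muley ?lte_fin// -EFinM.
  case: (boolP (y \in box w)) => [yb|_]; last first.
    by rewrite (gt0_muley (_ : 0 < (1 - t)%:E)%E) ?lte_fin// addey ?leey// -EFinM.
  rewrite mem_set.
    by rewrite -!EFinM -EFinD lee_fin le_eqVlt; apply/orP; left; apply/eqP; ring.
  move: xb yb; rewrite !inE => xb yb i; rewrite /= in_itv/= !mxE.
  have /andP[x1 x2] := box_coord i xb; have /andP[y1 y2] := box_coord i yb.
  by apply/andP; split; nra.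
move=> x; rewrite cube_densityE indicE.
by case: ifP => _ /=; rewrite ?mulr0// mulr1 opprK lnK// posrE.
Qed.

Lemma measurable_box a : measurable (box a).
Proof.
rewrite (_ : box a = \bigcap_(i in [set: 'I_n]) [set x | `[(- a)%R, a]%classic (x 0 i)]).
  apply: fin_bigcap_measurable => // i _.
  have mc : measurable_fun setT (fun x : 'rV[R]_n => x 0 i) by exact: measurable_coord.
  by rewrite -[X in measurable X]setTI; apply: mc.
by apply/seteqP; split=> [x bx i _|x bx i]; exact: bx.
Qed.

Definition cube_mu : set 'rV[R]_n -> \bar R :=
  mscale (NngNum (ltW c0)) (mrestr lam (measurable_box w)).

HB.instance Definition _ := Measure.on cube_mu.

Lemma cube_muE A : measurable A -> (cube_mu A = \int[lam]_(x in A) (F x)%:E)%E.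
Proof.
move=> mA; rewrite /cube_mu /mscale /mrestr/=.
have mAb : measurable (A `&` box w) by apply: measurableI => //; exact: measurable_box.
transitivity (\int[lam]_x (c%:E * (\1_(A `&` box w) x)%:E))%E.
  rewrite ge0_integralZl//; last 2 first.
  - by apply/measurable_EFinP; exact: measurable_indic.
  - by rewrite lee_fin ltW.
  by rewrite integral_indic// setIT.
rewrite (integral_mkcond A); apply: eq_integral => x _.
rewrite patchE cube_densityE !indicE in_setI -EFinM.
by case: (x \in A); rewrite //= mulr0.
Qed.

Let cube_muT : cube_mu setT = 1%E.
Proof. by rewrite cube_muE. Qed.

HB.instance Definition _ := @Measure_isProbability.Build _ _ R cube_mu cube_muT.

Lemma cube_isotropic_log_concave : isotropic_log_concave cube_mu.
Proof.
exists (fun x => (F x)%:E); split.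
- split; first exact/measurable_EFinP.
  exact: cube_muE.
- exact: cube_log_concave.
- exact: cube_isotropic.
Qed.

Hypothesis n0 : (0 < n)%N.

Let nR0 : 0 < n%:R :> R. Proof. by rewrite ltr0n. Qed.

(** Small enough to leave room for the slabs inside the cube, yet
    (a / w)^(n - 1) >= 1/2 by Bernoulli's inequality. *)
Let a : R := w * (1 - (2 * n%:R)^-1).

Let half_n : 0 < ((2 * n%:R)^-1 : R) <= 2^-1.
Proof.
have n2 : 0 < 2 * n%:R :> R by rewrite mulr_gt0.
by rewrite invr_gt0 n2/= lef_pV2 ?posrE// ler_peMr// ler1n.
Qed.

Let a_bounds : 0 < a < w.
Proof.
have /andP[h1 h2] := half_n.
rewrite /a mulr_gt0 ?subr_gt0//=; last by lra.
by rewrite gtr_pMr// gtrDl oppr_lt0.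
Qed.

Lemma box_convex_body (b : R) : 0 < b -> convex_body (box b).
Proof.
move=> b0; split.
- exact: (@rV_compact R n (fun=> `[(- b)%R, b]%classic) (fun=> @segment_compact _ _ _)).
- move=> x y t; rewrite !inE => xb yb i; rewrite /= in_itv/= !mxE.
  have /andP[x1 x2] := box_coord i xb; have /andP[y1 y2] := box_coord i yb.
  have t0 : 0 <= t%:num by [].
  have t1 : t%:num <= 1 by [].
  by apply/andP; split; rewrite /unstable.onem; nra.
- exists 0; apply/nbhs_ballP; exists b => //= x [_ xb] i.
  have := xb 0 i; rewrite /ball/= mxE sub0r normrN => /ltW.
  by rewrite ler_norml in_itv.
Qed.

(** The prism of thickness eps over the facet x_i = a. *)
Let slab (eps : R) (i : 'I_n) : set 'rV[R]_n :=
  [set x | forall j, (if j == i then `]a, (a + eps)%R]%classic else `[(- a)%R, a]%classic) (x 0 j)].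

Let slab_sub eps i : 0 < eps -> slab eps i `<=` parallel_body (box a) eps `\` box a.
Proof.
move=> eps0 x sx; have := sx i; rewrite eqxx/= in_itv/= => /andP[ax xa].
have /andP[a0 aw] := a_bounds.
split; last by move=> /(box_coord i)/andP[_]; lra.
pose d : 'rV[R]_n := delta_mx 0 i.
exists (x - (x 0 i - a) *: d).
  apply/boxE => j; rewrite !mxE eqxx/=.
  have [->|ji] := eqVneq j i; first by rewrite mulr1; apply/andP; split; lra.
  by have := sx j; rewrite (negbTE ji)/= in_itv/= mulr0 subr0.
exists (((x 0 i - a) / eps) *: d); last first.
  by rewrite scalerA mulrC mulfVK ?gt_eqF// subrK.
rewrite /euclid_ball/= euclid_norm_le// expr1n !dotE.
have -> : dot d d = 1.
  rewrite /dot (bigD1 i)//= big1 => [|j ji]; last by rewrite !mxE (negbTE ji) andbF mul0r.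
  by rewrite !mxE !eqxx mulr1 addr0.
rewrite mulr1 -expr2 expr_le1// ?divr_ge0 ?ler_pdivrMr ?mul1r; lra.
Qed.

Let measurable_slab_side eps i j : measurable
  (if j == i :> 'I_n then `]a, (a + eps)%R]%classic else `[(- a)%R, a]%classic : set R).
Proof. by case: ifP. Qed.

Let measurable_slab eps i : measurable (slab eps i).
Proof.
rewrite (_ : slab eps i = \bigcap_(j in [set: 'I_n]) [set x | (if j == i then
    `]a, (a + eps)%R]%classic else `[(- a)%R, a]%classic) (x 0 j)]).
  apply: fin_bigcap_measurable => // j _.
  have mc : measurable_fun setT (fun x : 'rV[R]_n => x 0 j) by exact: measurable_coord.
  by rewrite -[X in measurable X]setTI; apply: mc.
by apply/seteqP; split=> [x bx j _|x bx j]; exact: bx.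
Qed.

Let slab_mass eps i : 0 < eps < w - a ->
  (cube_mu (slab eps i) = (c * (eps * (2 * a) ^+ n.-1))%:E)%E.
Proof.
move=> /andP[eps0 epsw]; have /andP[a0 aw] := a_bounds.
have -> : cube_mu (slab eps i) = (c%:E * lam (slab eps i `&` box w))%E by [].
rewrite setIidl; last first.
  move=> x sx; apply/boxE => j; have := sx j.
  by case: ifP => _; rewrite /= in_itv/= => /andP[? ?]; apply/andP; split; lra.
rewrite EFinM; congr (_ * _)%E.
have := @lebesgue_rV_box R n _ (measurable_slab_side eps i).
move=> ->; rewrite (bigD1 i)//= eqxx lebesgue_measure_itv/= lte_fin ltrDl eps0.
rewrite -EFinB addrAC subrr add0r EFinM; congr (_ * _)%E.
rewrite (eq_bigr (fun=> (2 * a)%:E)) => [|j ji]; last first.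
  rewrite (negbTE ji) lebesgue_measure_itv/= lte_fin ifT; last by lra.
  by rewrite -EFinB; congr (_%:E); lra.
rewrite prodEFin; congr (_%:E).
by rewrite prodr_const (_ : #|_| = n.-1)// -[in RHS](card_ord n) (cardC1 i).
Qed.

Let trivIset_slab eps : trivIset [set: 'I_n] (slab eps).
Proof.
move=> i j _ _ [x [/= si sj]]; apply: contrapT => /eqP ij.
have := si i; have := sj i; rewrite eqxx (negbTE ij)/= !in_itv/=.
by move=> /andP[_ xa] /andP[ax _]; lra.
Qed.

(** The n slabs are disjoint, each of mass eps (a / w)^(n - 1) / (2 w). *)
Lemma perimeter_box_ge : ((n%:R / 8)%:E <= perimeter cube_mu (box a))%E.
Proof.
have /andP[a0 aw] := a_bounds.
have mA := measurable_box a.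
have mP eps : measurable (parallel_body (box a) eps).
  apply: closed_rV_measurable; apply: compact_closed; first exact: norm_hausdorff.
  by apply: compact_parallel_body; have [] := box_convex_body a0.
rewrite /perimeter limf_einfE.
pose V : set R := [set eps | 0 < eps < w - a].
apply: (@le_trans _ _ (ereal_inf [set ((cube_mu (parallel_body (box a) eps) -
    cube_mu (box a)) * eps^-1%:E)%E | eps in V])); last first.
  apply: ereal_sup_ubound; exists V => //.
  near=> eps; apply/andP; split; near: eps; first exact: nbhs_right_gt.
  by apply: nbhs_right_lt; rewrite subr_gt0.
apply: le_ereal_inf_tmp => _ [eps Veps <-]; have /andP[eps0 epsw] := Veps.
rewrite lee_pdivlMr// -EFinM.
have <- : cube_mu (parallel_body (box a) eps `\` box a) =
    (cube_mu (parallel_body (box a) eps) - cube_mu (box a))%E.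
  rewrite measureD ?setIidr//; first exact: sub_parallel_body.
  by apply: le_lt_trans (probability_le1 _ (mP eps)) _; rewrite ltry.
apply: (@le_trans _ _ (cube_mu (\big[setU/set0]_(i < n) slab eps i))); last first.
  apply: le_measure; rewrite ?inE.
  - by apply: bigsetU_measurable => i _; exact: measurable_slab.
  - exact: measurableD.
  - apply: (big_ind (fun S => S `<=` _)) => [//|A B sA sB x [/sA|/sB]//|i _].
    exact: slab_sub.
rewrite (measure_bigsetU_ord _ _ (measurable_slab eps) (@trivIset_slab eps)).
rewrite (eq_bigr (fun=> (c * (eps * (2 * a) ^+ n.-1))%:E)) => [|i _]; last exact: slab_mass.
rewrite sumEFin lee_fin sumr_const card_ord.
have face : 8^-1 <= c * (2 * a) ^+ n.-1.
  have -> : c * (2 * a) ^+ n.-1 = (2 * w)^-1 * (1 - (2 * n%:R)^-1) ^+ n.-1.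
    have w2 : 2 * w != 0 by rewrite gt_eqF// mulr_gt0.
    rewrite /c /a mulrA exprMn -{1}(prednK n0) exprS exprVn -!mulrA; congr (_ * _).
    by rewrite mulrA mulVf ?mul1r// expf_neq0.
  have /andP[h1 h2] := half_n.
  have rho : (2^-1 : R) <= (1 - (2 * n%:R)^-1) ^+ n.-1.
    apply: le_trans (@bernoulli_onem R n.-1 (2 * n%:R)^-1 _); last by apply/andP; split; lra.
    have : n.-1%:R * (2 * n%:R)^-1 <= 2^-1 :> R.
      rewrite invfM mulrCA ler_piMr// ler_pdivrMr// mul1r ler_nat.
      exact: leq_pred.
    by lra.
  have w2 : w <= 2.
    by rewrite -(@ler_pXn2r _ 2)// ?nnegrE ?ltW// ww; lra.
  have : (4^-1 : R) <= (2 * w)^-1 by rewrite lef_pV2 ?posrE ?mulr_gt0//; lra.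
  by nra.
rewrite [leRHS](_ : _ = (c * (2 * a) ^+ n.-1) * (n%:R * eps)); last by rewrite -[_ *+ n]mulr_natr; ring.
rewrite [leLHS](_ : _ = 8^-1 * (n%:R * eps)); last by field.
by rewrite ler_wpM2r// mulr_ge0// ltW.
Unshelve. all: by end_near. Qed.

Lemma Gamma_ge : ((n%:R / 8)%:E <= Gamma R n)%E.
Proof.
have /andP[a0 _] := a_bounds.
apply: le_trans perimeter_box_ge _.
apply: (@le_trans _ _ (max_perimeter cube_mu)).
  by apply: ereal_sup_ubound; exists (box a) => //; exact: box_convex_body.
by apply: ereal_sup_ubound; exists cube_mu => //; exact: cube_isotropic_log_concave.
Qed.

End cube.

Theorem theorem1p2 (R : realType) :
  exists c1 c2 : R, [/\ 0 < c1, 0 < c2 &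
    forall n : nat, (0 < n)%N ->
      ((c1 * n%:R)%:E <= Gamma R n)%E /\ (Gamma R n <= (c2 * n%:R)%:E)%E].
Proof.
exists 8^-1, (136 * (decay R + 1)); split.
- by rewrite invr_gt0.
- by rewrite mulr_gt0// ltr_wpDl// decay_ge0.
move=> n n0; split; last exact: Gamma_le.
by rewrite mulrC; exact: Gamma_ge.
Qed.
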